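(* Let $a>0$, let $\lambda,\mu\in\mathbb{C}$ with $0<\operatorname{Re}(\mu)<\operatorname{Re}(\lambda)$, and let $y\in\mathbb{C}$. Put $D(x)=x+a+\sqrt{x^{2}+2ax}$ for $x>0$. Then \[ \int_{0}^{\infty}x^{\mu-1}D(x)^{-\lambda}\left[I_{0}\!\left(\frac{y}{D(x)}\right)+\mathbf{L}_{0}\!\left(\frac{y}{D(x)}\right)\right]dx =\frac{2^{1-\mu}a^{\mu-\lambda}\Gamma(2\mu)}{\sqrt{\pi}}\; {}_{3}\Psi_{3}\!\left[\begin{array}{c}(\tfrac12,\tfrac12),\ (\lambda+1,1),\ (\lambda-\mu,1)\\ (1,\tfrac12),\ (\lambda,1),\ (1+\lambda+\mu,1)\end{array}\Bigg|\ \frac{y}{a}\right]. \]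
   Context: $I_{0}$ is the modified Bessel function of the first kind of order $0$ and $\mathbf{L}_{0}$ is the modified Struve function of order $0$. The generalized Wright function is ${}_{p}\Psi_{q}\!\left[\begin{array}{c}(a_i,\alpha_i)_{1,p}\\(b_j,\beta_j)_{1,q}\end{array}\Big|z\right]=\sum_{k=0}^{\infty}\frac{\prod_{i=1}^{p}\Gamma(a_i+\alpha_i k)}{\prod_{j=1}^{q}\Gamma(b_j+\beta_j k)}\frac{z^{k}}{k!}$, with $a_i,b_j\in\mathbb{C}$, $\alpha_i,\beta_j\in\mathbb{R}$. *)

(* Defs.v *)
From Stdlib Require Import Reals Lra List Arith Factorial ClassicalEpsilon.
Open Scope R_scope.

Record Cplx : Type := mkC { Re : R; Im : R }.

Definition RtoC (x : R) : Cplx := mkC x 0.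
Definition Czero : Cplx := RtoC 0.
Definition Cone : Cplx := RtoC 1.
Definition Cadd (z w : Cplx) : Cplx := mkC (Re z + Re w) (Im z + Im w).
Definition Copp (z : Cplx) : Cplx := mkC (- Re z) (- Im z).
Definition Csub (z w : Cplx) : Cplx := Cadd z (Copp w).
Definition Cmul (z w : Cplx) : Cplx :=
  mkC (Re z * Re w - Im z * Im w) (Re z * Im w + Im z * Re w).
Definition Cinv (z : Cplx) : Cplx :=
  let d := Re z * Re z + Im z * Im z in mkC (Re z / d) (- Im z / d).
Definition Cdiv (z w : Cplx) : Cplx := Cmul z (Cinv w).
Definition Cnorm (z : Cplx) : R := sqrt (Re z * Re z + Im z * Im z).
Fixpoint Cpow (z : Cplx) (n : nat) : Cplx :=
  match n with O => Cone | S n => Cmul z (Cpow z n) end.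

Definition Cexp (z : Cplx) : Cplx := mkC (exp (Re z) * cos (Im z)) (exp (Re z) * sin (Im z)).
Definition Rcpow (x : R) (w : Cplx) : Cplx := Cexp (Cmul w (RtoC (ln x))).

Fixpoint Csum_nat (f : nat -> Cplx) (n : nat) : Cplx :=
  match n with O => f O | S m => Cadd (Csum_nat f m) (f n) end.
Fixpoint Cprod_nat (f : nat -> Cplx) (n : nat) : Cplx :=
  match n with O => f O | S m => Cmul (Cprod_nat f m) (f n) end.
Definition Cprod_list (l : list Cplx) : Cplx := fold_right Cmul Cone l.

Definition Cseq_cv (u : nat -> Cplx) (l : Cplx) : Prop :=
  Un_cv (fun n => Re (u n)) (Re l) /\ Un_cv (fun n => Im (u n)) (Im l).
Definition Cseries_cv (u : nat -> Cplx) (s : Cplx) : Prop := Cseq_cv (Csum_nat u) s.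

Lemma C_inhabited : inhabited Cplx. Proof. exact (inhabits Czero). Qed.

Definition Cseries_sum (u : nat -> Cplx) : Cplx := epsilon C_inhabited (Cseries_cv u).

(** Euler's Gamma function via Gauss' limit formula
    Gamma z = lim n! n^z / (z (z+1) ... (z+n)). *)
Definition gamma_seq (z : Cplx) (n : nat) : Cplx :=
  Cdiv (Cmul (RtoC (INR (fact n))) (Rcpow (INR n) z))
       (Cprod_nat (fun k => Cadd z (RtoC (INR k))) n).
Definition CGamma (z : Cplx) : Cplx := epsilon C_inhabited (Cseq_cv (gamma_seq z)).

Definition besselI0 (z : Cplx) : Cplx :=
  Cseries_sum (fun k => Cdiv (Cpow (Cdiv z (RtoC 2)) (2 * k))
                             (RtoC (INR (fact k) * INR (fact k)))).
Definition struveL0 (z : Cplx) : Cplx :=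
  Cseries_sum (fun k => Cdiv (Cpow (Cdiv z (RtoC 2)) (2 * k + 1))
                             (Cmul (CGamma (RtoC (INR k + 3/2)))
                                   (CGamma (RtoC (INR k + 3/2))))).

Definition wright_term (A B : list (Cplx * R)) (z : Cplx) (k : nat) : Cplx :=
  Cdiv (Cmul (Cprod_list (map (fun p => CGamma (Cadd (fst p) (RtoC (snd p * INR k)))) A))
             (Cpow z k))
       (Cmul (Cprod_list (map (fun p => CGamma (Cadd (fst p) (RtoC (snd p * INR k)))) B))
             (RtoC (INR (fact k)))).
Definition wrightPsi (A B : list (Cplx * R)) (z : Cplx) : Cplx :=
  Cseries_sum (wright_term A B z).

Definition improper_int_0_inf (f : R -> Cplx) (I : Cplx) : Prop :=
  forall eps : R, eps > 0 ->
    exists delta M : R, delta > 0 /\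
      forall e b : R, 0 < e < delta -> M < b ->
        exists (pr1 : Riemann_integrable (fun x => Re (f x)) e b)
               (pr2 : Riemann_integrable (fun x => Im (f x)) e b),
          Cnorm (Csub (mkC (RiemannInt pr1) (RiemannInt pr2)) I) < eps.

Definition Dfun (a x : R) : R := x + a + sqrt (x * x + 2 * a * x).

(* Main.v *)
(** The substitution u = a / D(x), for which x = (a/2)(1-u)^2/u, turns the integral into
    (a/2)^mu a^(-lam) times the integral over (0,1) of
    u^(lam-mu-1) (1-u)^(2mu-1) (1+u) S(y u / a), where S = I_0 + L_0 has the single power series
    S(z) = sum_k (z/2)^k / Gamma(k/2+1)^2. Integrating term by term gives
    B(lam-mu+k, 2mu) + B(lam-mu+k+1, 2mu), and Euler's B(p,q) = Gamma(p) Gamma(q) / Gamma(p+q)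
    together with the duplication formula at the half-integers yields the terms of the Wright
    series. The n-th term of Gauss' product is n^p B(p, n+1); since
    |B(p, q+n+1) - B(p, n+1)| <= C B(Re p + 1, n), also n^p B(p, q+n+1) tends to Gamma(p), and
    Euler's formula follows by letting n tend to infinity in the recurrence for B in q. *)

From Coquelicot Require Import Coquelicot.
Require Import Defs.
From Stdlib Require Import Reals List Arith Factorial Lra Lia Classical ClassicalEpsilon
  FunctionalExtensionality.
Open Scope R_scope.

(** * Field structure, norm and powers *)

(* [CGamma], [Cseries_sum] and [Beta] are choices by [epsilon]: they carry information only once a
   limit has been shown to exist. Convergence of Gauss' product is therefore proved on the
   half-plane of positive real part, which contains every argument that occurs, and the limit is
   shown to be nonzero there because Gammas stand in denominators. The other obstacle is the
   exchange of the sum with an integral that is improper at both ends. The Beta integrand is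
   dominated by a sum of two powers with an explicit primitive [H], so truncating to an inner
   interval costs at most increments of [H] near 0 and 1. Since [u^k <= 1], this cost is the same
   for every term of the series, while an exponential series controls the coefficients; the exchange
   then reduces to finite sums and compact intervals. Analysis is carried out on real and imaginary
   parts separately, which is the source of the factors 2 in the complex estimates. *)
Declare Scope cplx_scope.
Delimit Scope cplx_scope with cx.
Infix "+" := Cadd : cplx_scope.
Infix "-" := Csub : cplx_scope.
Infix "*" := Cmul : cplx_scope.
Infix "/" := Cdiv : cplx_scope.
Notation "- z" := (Copp z) : cplx_scope.

Lemma Cplx_eq (z w : Cplx) : Re z = Re w -> Im z = Im w -> z = w.
Proof. destruct z, w; simpl; intros -> ->; reflexivity. Qed.

Lemma Cplx_ring_theory :
  ring_theory Czero Cone Cadd Cmul Csub Copp (@eq Cplx).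
Proof. constructor; intros; apply Cplx_eq; simpl; ring. Qed.

Lemma Cplx_norm2_pos (z : Cplx) : z <> Czero -> 0 < Re z * Re z + Im z * Im z.
Proof.
  intros hz.
  destruct (Req_dec (Re z) 0) as [h1|h1], (Req_dec (Im z) 0) as [h2|h2]; try nra.
  exfalso; apply hz, Cplx_eq; simpl; assumption.
Qed.

Lemma Cplx_field_theory :
  field_theory Czero Cone Cadd Cmul Csub Copp Cdiv Cinv (@eq Cplx).
Proof.
  constructor.
  - apply Cplx_ring_theory.
  - intros h; injection h; lra.
  - reflexivity.
  - intros z hz; pose proof (Cplx_norm2_pos z hz).
    apply Cplx_eq; simpl; field; lra.
Qed.

Add Field Cplx_field : Cplx_field_theory.

Lemma RtoC_add (x y : R) : RtoC (x + y) = (RtoC x + RtoC y)%cx.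
Proof. apply Cplx_eq; simpl; ring. Qed.
Lemma RtoC_sub (x y : R) : RtoC (x - y) = (RtoC x - RtoC y)%cx.
Proof. apply Cplx_eq; simpl; ring. Qed.
Lemma RtoC_opp (x : R) : RtoC (- x) = (- RtoC x)%cx.
Proof. apply Cplx_eq; simpl; ring. Qed.
Lemma RtoC_mul (x y : R) : RtoC (x * y) = (RtoC x * RtoC y)%cx.
Proof. apply Cplx_eq; simpl; ring. Qed.
Lemma RtoC_neq0 (x : R) : x <> 0 -> RtoC x <> Czero.
Proof. intros h e; injection e; exact h. Qed.
Lemma RtoC_div (x y : R) : y <> 0 -> RtoC (x / y) = (RtoC x / RtoC y)%cx.
Proof. intros h; apply Cplx_eq; simpl; field; exact h. Qed.
Lemma RtoC_pow (x : R) (n : nat) : RtoC (x ^ n) = Cpow (RtoC x) n.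
Proof. induction n; [reflexivity|]. simpl; rewrite RtoC_mul, IHn; reflexivity. Qed.

Lemma Cpos_neq0 (z : Cplx) : 0 < Re z -> z <> Czero.
Proof. intros h e; rewrite e in h; simpl in h; lra. Qed.

Lemma Cmul_integral (z w : Cplx) : (z * w)%cx = Czero -> z = Czero \/ w = Czero.
Proof.
  intros h; destruct (classic (z = Czero)) as [hz|hz]; [left; exact hz|right].
  replace w with (Cinv z * (z * w))%cx by (field; exact hz).
  rewrite h; ring.
Qed.

Lemma Cmul_neq0 (z w : Cplx) : z <> Czero -> w <> Czero -> (z * w)%cx <> Czero.
Proof. intros hz hw h; destruct (Cmul_integral _ _ h); contradiction. Qed.

Lemma Cpow_mul (z w : Cplx) (n : nat) : Cpow (z * w)%cx n = (Cpow z n * Cpow w n)%cx.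
Proof. induction n; simpl; [ring|rewrite IHn; ring]. Qed.

Lemma Cnorm_Cmod (z : Cplx) : Cnorm z = Cmod (Re z, Im z).
Proof. unfold Cnorm, Cmod; simpl; f_equal; ring. Qed.

Lemma Cnorm_mul (z w : Cplx) : Cnorm (z * w)%cx = Cnorm z * Cnorm w.
Proof. rewrite !Cnorm_Cmod, <- Cmod_mult; reflexivity. Qed.

Lemma Cnorm_add (z w : Cplx) : Cnorm (z + w)%cx <= Cnorm z + Cnorm w.
Proof. rewrite !Cnorm_Cmod. apply (Cmod_triangle (Re z, Im z) (Re w, Im w)). Qed.

Lemma Cnorm_pos (z : Cplx) : 0 <= Cnorm z.
Proof. apply sqrt_pos. Qed.

Lemma Cnorm_RtoC (x : R) : Cnorm (RtoC x) = Rabs x.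
Proof. unfold Cnorm; simpl. rewrite Rmult_0_l, Rplus_0_r. apply sqrt_Rsqr_abs. Qed.

Lemma Cnorm_opp (z : Cplx) : Cnorm (- z)%cx = Cnorm z.
Proof. unfold Cnorm; simpl; f_equal; ring. Qed.

Lemma Cnorm_sub_sym (z w : Cplx) : Cnorm (z - w)%cx = Cnorm (w - z)%cx.
Proof. unfold Cnorm; simpl; f_equal; ring. Qed.

Lemma Cnorm_Re (z : Cplx) : Rabs (Re z) <= Cnorm z.
Proof. rewrite Cnorm_Cmod. apply (Rle_trans _ _ _ (Rmax_l _ _) (Rmax_Cmod (Re z, Im z))). Qed.

Lemma Cnorm_Im (z : Cplx) : Rabs (Im z) <= Cnorm z.
Proof. rewrite Cnorm_Cmod. apply (Rle_trans _ _ _ (Rmax_r _ _) (Rmax_Cmod (Re z, Im z))). Qed.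

(** Triangle inequality for [z = x + i y]. With [Cnorm_Re] and [Cnorm_Im] it carries estimates back
    and forth between the norm and the two components. *)
Lemma Cnorm_le_Re_Im (z : Cplx) : Cnorm z <= Rabs (Re z) + Rabs (Im z).
Proof.
  replace z with (RtoC (Re z) + mkC 0 1 * RtoC (Im z))%cx
    by (apply Cplx_eq; simpl; ring).
  eapply Rle_trans; [apply Cnorm_add|].
  rewrite Cnorm_mul, !Cnorm_RtoC.
  replace (Cnorm (mkC 0 1)) with 1
    by (unfold Cnorm; simpl; rewrite Rmult_0_l, Rplus_0_l, Rmult_1_l, sqrt_1; reflexivity).
  simpl. right; f_equal; [f_equal; ring|]. rewrite Rmult_1_l; f_equal; ring.
Qed.

Lemma Cnorm_pow (z : Cplx) (n : nat) : Cnorm (Cpow z n) = Cnorm z ^ n.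
Proof.
  induction n; simpl.
  - unfold Cone; rewrite Cnorm_RtoC; apply Rabs_R1.
  - rewrite Cnorm_mul, IHn; reflexivity.
Qed.

Lemma Rcpow_eq (x : R) (w : Cplx) :
  Rcpow x w = mkC (exp (Re w * ln x) * cos (Im w * ln x))
                  (exp (Re w * ln x) * sin (Im w * ln x)).
Proof.
  unfold Rcpow, Cexp; simpl.
  replace (Re w * ln x - Im w * 0) with (Re w * ln x) by ring.
  replace (Re w * 0 + Im w * ln x) with (Im w * ln x) by ring.
  reflexivity.
Qed.

Lemma Rcpow_add (x : R) (z w : Cplx) : Rcpow x (z + w)%cx = (Rcpow x z * Rcpow x w)%cx.
Proof.
  rewrite !Rcpow_eq; apply Cplx_eq; simpl;
  rewrite !Rmult_plus_distr_r, exp_plus, ?cos_plus, ?sin_plus; ring.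
Qed.

Lemma Rcpow_mult (x y : R) (w : Cplx) :
  0 < x -> 0 < y -> Rcpow (x * y) w = (Rcpow x w * Rcpow y w)%cx.
Proof.
  intros hx hy; rewrite !Rcpow_eq, ln_mult by assumption; apply Cplx_eq; simpl;
  rewrite !Rmult_plus_distr_l, exp_plus, ?cos_plus, ?sin_plus; ring.
Qed.

Lemma Rcpow_0 (x : R) : Rcpow x Czero = Cone.
Proof.
  rewrite Rcpow_eq; apply Cplx_eq; simpl; rewrite !Rmult_0_l, exp_0, ?cos_0, ?sin_0; ring.
Qed.

Lemma Rcpow_RtoC (x r : R) : Rcpow x (RtoC r) = RtoC (exp (r * ln x)).
Proof.
  rewrite Rcpow_eq; apply Cplx_eq; simpl; rewrite !Rmult_0_l, ?cos_0, ?sin_0; ring.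
Qed.

Lemma Rcpow_1l (w : Cplx) : Rcpow 1 w = Cone.
Proof.
  rewrite Rcpow_eq, ln_1; apply Cplx_eq; simpl; rewrite !Rmult_0_r, exp_0, ?cos_0, ?sin_0; ring.
Qed.

Lemma Rcpow_nat (x : R) (n : nat) : 0 < x -> Rcpow x (RtoC (INR n)) = RtoC (x ^ n).
Proof. intros hx; rewrite Rcpow_RtoC, <- (Rpower_pow n x hx); reflexivity. Qed.

Lemma Rcpow_1 (x : R) : 0 < x -> Rcpow x Cone = RtoC x.
Proof. intros hx; unfold Cone; rewrite Rcpow_RtoC, Rmult_1_l, exp_ln by exact hx; reflexivity. Qed.

Lemma Cnorm_Rcpow (x : R) (w : Cplx) : Cnorm (Rcpow x w) = exp (Re w * ln x).
Proof.
  rewrite Rcpow_eq; unfold Cnorm; simpl.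
  set (e := exp _); set (t := Im w * ln x).
  replace (e * cos t * (e * cos t) + e * sin t * (e * sin t))
    with (Rsqr e * (Rsqr (sin t) + Rsqr (cos t))) by (unfold Rsqr; ring).
  rewrite sin2_cos2, Rmult_1_r, sqrt_Rsqr; [reflexivity|]. left; apply exp_pos.
Qed.

Lemma Rcpow_neq0 (x : R) (w : Cplx) : Rcpow x w <> Czero.
Proof.
  intros h; pose proof (Cnorm_Rcpow x w) as e; rewrite h in e.
  unfold Czero in e; rewrite Cnorm_RtoC, Rabs_R0 in e.
  pose proof (exp_pos (Re w * ln x)); lra.
Qed.

Lemma Rcpow_opp (x : R) (w : Cplx) : Rcpow x (- w)%cx = Cinv (Rcpow x w).
Proof.
  assert (h : (Rcpow x w * Rcpow x (- w) = Cone)%cx).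
  { rewrite <- Rcpow_add, <- (Rcpow_0 x); f_equal; ring. }
  replace (Rcpow x (- w)%cx) with (Cinv (Rcpow x w) * (Rcpow x w * Rcpow x (- w)))%cx
    by (field; apply Rcpow_neq0).
  rewrite h; ring.
Qed.

Lemma Rcpow_inv (x : R) (w : Cplx) : 0 < x -> Rcpow (/ x) w = Cinv (Rcpow x w).
Proof.
  intros hx.
  assert (h : (Rcpow x w * Rcpow (/ x) w = Cone)%cx).
  { rewrite <- Rcpow_mult, Rinv_r, Rcpow_1l;
      [reflexivity|lra|exact hx|apply Rinv_0_lt_compat, hx]. }
  replace (Rcpow (/ x) w) with (Cinv (Rcpow x w) * (Rcpow x w * Rcpow (/ x) w))%cx
    by (field; apply Rcpow_neq0).
  rewrite h; ring.
Qed.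

Lemma Rcpow_sub (x : R) (z w : Cplx) : Rcpow x (z - w)%cx = (Rcpow x z / Rcpow x w)%cx.
Proof. unfold Csub; rewrite Rcpow_add, Rcpow_opp; reflexivity. Qed.

(** * Continuity and derivatives of complex-valued functions of a real variable *)

Definition Ccontinuous (f : R -> Cplx) (x : R) : Prop :=
  continuous (fun t => Re (f t)) x /\ continuous (fun t => Im (f t)) x.

Definition is_Cderive (f : R -> Cplx) (x : R) (l : Cplx) : Prop :=
  is_derive (fun t => Re (f t)) x (Re l) /\ is_derive (fun t => Im (f t)) x (Im l).

Lemma Ccontinuous_add (f g : R -> Cplx) (x : R) :
  Ccontinuous f x -> Ccontinuous g x -> Ccontinuous (fun t => f t + g t)%cx x.
Proof.
  intros [f1 f2] [g1 g2]; split; simpl.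
  - apply (continuous_plus (fun t => Re (f t)) (fun t => Re (g t))); assumption.
  - apply (continuous_plus (fun t => Im (f t)) (fun t => Im (g t))); assumption.
Qed.

Lemma Ccontinuous_mul (f g : R -> Cplx) (x : R) :
  Ccontinuous f x -> Ccontinuous g x -> Ccontinuous (fun t => f t * g t)%cx x.
Proof.
  intros [f1 f2] [g1 g2]; split; simpl.
  - apply (continuous_minus (fun t => Re (f t) * Re (g t)) (fun t => Im (f t) * Im (g t)));
    apply (continuous_mult (K := R_AbsRing)); assumption.
  - apply (continuous_plus (fun t => Re (f t) * Im (g t)) (fun t => Im (f t) * Re (g t)));
    apply (continuous_mult (K := R_AbsRing)); assumption.
Qed.

Lemma Ccontinuous_const (c : Cplx) (x : R) : Ccontinuous (fun _ => c) x.
Proof. split; apply continuous_const. Qed.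

Lemma Ccontinuous_RtoC (f : R -> R) (x : R) :
  continuous f x -> Ccontinuous (fun t => RtoC (f t)) x.
Proof. intros h; split; simpl; [exact h|apply continuous_const]. Qed.

Lemma is_derive_continuous (f : R -> R) (x l : R) : is_derive f x l -> continuous f x.
Proof.
  intros h; apply (ex_derive_continuous (K := R_AbsRing) (V := R_NormedModule) f).
  exists l; exact h.
Qed.

Lemma is_Cderive_continuous (f : R -> Cplx) (x : R) (l : Cplx) :
  is_Cderive f x l -> Ccontinuous f x.
Proof.
  intros [h1 h2]; split; eapply is_derive_continuous; eassumption.
Qed.

Lemma is_Cderive_mul (f g : R -> Cplx) (x : R) (lf lg : Cplx) :
  is_Cderive f x lf -> is_Cderive g x lg ->
  is_Cderive (fun t => f t * g t)%cx x (lf * g x + f x * lg)%cx.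
Proof.
  intros [f1 f2] [g1 g2]; split; simpl.
  - replace (Re lf * Re (g x) - Im lf * Im (g x) + (Re (f x) * Re lg - Im (f x) * Im lg))
      with (minus (plus (mult (Re lf) (Re (g x))) (mult (Re (f x)) (Re lg)))
                  (plus (mult (Im lf) (Im (g x))) (mult (Im (f x)) (Im lg))))
      by (unfold minus, plus, mult, opp; simpl; ring).
    apply (is_derive_minus (fun t => Re (f t) * Re (g t)) (fun t => Im (f t) * Im (g t)));
    apply (is_derive_mult (fun t => _ (f t)) (fun t => _ (g t)));
      try assumption; intros; apply Rmult_comm.
  - replace (Re lf * Im (g x) + Im lf * Re (g x) + (Re (f x) * Im lg + Im (f x) * Re lg))
      with (plus (plus (mult (Re lf) (Im (g x))) (mult (Re (f x)) (Im lg)))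
                  (plus (mult (Im lf) (Re (g x))) (mult (Im (f x)) (Re lg))))
      by (unfold plus, mult; simpl; ring).
    apply (is_derive_plus (fun t => Re (f t) * Im (g t)) (fun t => Im (f t) * Re (g t)));
    apply (is_derive_mult (fun t => _ (f t)) (fun t => _ (g t)));
      try assumption; intros; apply Rmult_comm.
Qed.

Lemma is_Cderive_ext_l (f : R -> Cplx) (x : R) (l l' : Cplx) :
  l = l' -> is_Cderive f x l -> is_Cderive f x l'.
Proof. intros ->; exact (fun h => h). Qed.

(** Stated for a composite [g], so that it serves both [u^w] and [(1 - u)^w]. *)
Lemma is_Cderive_Rcpow (g : R -> R) (g' x : R) (w : Cplx) :
  is_derive g x g' -> 0 < g x ->
  is_Cderive (fun t => Rcpow (g t) w) x (RtoC g' * w * Rcpow (g x) (w - Cone))%cx.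
Proof.
  intros hg hx.
  rewrite Rcpow_sub, Rcpow_1 by exact hx.
  assert (hln : is_derive (fun t => ln (g t)) x (g' / g x)).
  { auto_derive; [split; [eexists; exact hg|split; [exact hx|exact I]]|].
    replace (Derive (fun t : R => g t) x) with g' by (symmetry; apply is_derive_unique, hg).
    field; lra. }
  assert (h : is_derive (fun t => exp (Re w * ln (g t)) * cos (Im w * ln (g t))) x
               (Re (RtoC g' * w * (Rcpow (g x) w / RtoC (g x)))%cx) /\
              is_derive (fun t => exp (Re w * ln (g t)) * sin (Im w * ln (g t))) x
               (Im (RtoC g' * w * (Rcpow (g x) w / RtoC (g x)))%cx)).
  { set (L := fun t => ln (g t)) in *.
    rewrite Rcpow_eq.
    change (ln (g x)) with (L x).
    change (is_derive (fun t => exp (Re w * L t) * cos (Im w * L t)) x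
               (Re (RtoC g' * w * (mkC (exp (Re w * L x) * cos (Im w * L x))
                  (exp (Re w * L x) * sin (Im w * L x)) / RtoC (g x)))%cx) /\
            is_derive (fun t => exp (Re w * L t) * sin (Im w * L t)) x
               (Im (RtoC g' * w * (mkC (exp (Re w * L x) * cos (Im w * L x))
                  (exp (Re w * L x) * sin (Im w * L x)) / RtoC (g x)))%cx)).
    split; (auto_derive; [repeat split; eexists; exact hln|]);
    replace (Derive (fun t : R => L t) x) with (g' / g x)
      by (symmetry; apply is_derive_unique, hln);
    simpl; field; lra. }
  destruct h as [h1 h2]; split.
  - eapply is_derive_ext; [|exact h1]; intros t; rewrite Rcpow_eq; reflexivity.
  - eapply is_derive_ext; [|exact h2]; intros t; rewrite Rcpow_eq; reflexivity.
Qed.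

Lemma Ccontinuous_Rcpow (g : R -> R) (x : R) (w : Cplx) :
  continuous g x -> 0 < g x -> Ccontinuous (fun t => Rcpow (g t) w) x.
Proof.
  intros hg hx.
  assert (h : Ccontinuous (fun t => Rcpow t w) (g x)).
  { eapply is_Cderive_continuous, (is_Cderive_Rcpow (fun t => t) 1);
      [apply (is_derive_id (K := R_AbsRing))|exact hx]. }
  destruct h as [h1 h2]; split.
  - apply (continuous_comp g (fun t => Re (Rcpow t w))); assumption.
  - apply (continuous_comp g (fun t => Im (Rcpow t w))); assumption.
Qed.

(* The factor 2 pays for applying the real mean value theorem to each component. *)
Lemma Cderive_bound (f f' : R -> Cplx) (a b K : R) :
  a <= b -> (forall x, a <= x <= b -> is_Cderive f x (f' x)) ->
  (forall x, a <= x <= b -> Cnorm (f' x) <= K) ->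
  Cnorm (f b - f a)%cx <= 2 * (K * (b - a)).
Proof.
  intros hab hd hK.
  assert (key : forall (g g' : R -> R),
    (forall x, a <= x <= b -> is_derive g x (g' x)) ->
    (forall x, a <= x <= b -> Rabs (g' x) <= K) ->
    Rabs (g b - g a) <= K * (b - a)).
  { intros g g' h1 h2.
    destruct (MVT_gen g a b g') as [c [hc e]].
    - intros x hx; apply h1; rewrite Rmin_left, Rmax_right in hx by exact hab; lra.
    - intros x hx; apply continuity_pt_filterlim.
      eapply is_derive_continuous, h1.
      rewrite Rmin_left, Rmax_right in hx by exact hab; lra.
    - rewrite Rmin_left, Rmax_right in hc by exact hab.
      rewrite e, Rabs_mult, (Rabs_pos_eq (b - a)) by lra.
      apply Rmult_le_compat_r; [lra|apply h2, hc]. }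
  eapply Rle_trans; [apply Cnorm_le_Re_Im|]; simpl.
  pose proof (key (fun x => Re (f x)) (fun x => Re (f' x))
    (fun x hx => proj1 (hd x hx))
    (fun x hx => Rle_trans _ _ _ (Cnorm_Re _) (hK x hx))) as k1.
  pose proof (key (fun x => Im (f x)) (fun x => Im (f' x))
    (fun x hx => proj2 (hd x hx))
    (fun x hx => Rle_trans _ _ _ (Cnorm_Im _) (hK x hx))) as k2.
  unfold Rminus in k1, k2; lra.
Qed.

(** * Gauss' product for the Gamma function *)

Lemma exp_le (x y : R) : x <= y -> exp x <= exp y.
Proof. intros [h|h]; [left; apply exp_increasing, h|right; f_equal; exact h]. Qed.

Lemma Cseq_cv_unique (u : nat -> Cplx) (l l' : Cplx) :
  Cseq_cv u l -> Cseq_cv u l' -> l = l'.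
Proof.
  intros [h1 h2] [h3 h4]; apply Cplx_eq; eapply UL_sequence; eassumption.
Qed.

Lemma Cseq_cv_ext (u v : nat -> Cplx) (l : Cplx) :
  (forall n, u n = v n) -> Cseq_cv u l -> Cseq_cv v l.
Proof.
  intros e [h1 h2]; split; intros eps he;
  [destruct (h1 eps he) as [N hN]|destruct (h2 eps he) as [N hN]];
  exists N; intros n hn; rewrite <- e; apply hN, hn.
Qed.

Lemma Cseq_cv_norm (u : nat -> Cplx) (l : Cplx) :
  Cseq_cv u l <->
  (forall eps, 0 < eps -> exists N, forall n, (N <= n)%nat -> Cnorm (u n - l)%cx < eps).
Proof.
  split.
  - intros [h1 h2] eps he.
    destruct (h1 (eps / 2)) as [N1 H1]; [lra|].
    destruct (h2 (eps / 2)) as [N2 H2]; [lra|].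
    exists (max N1 N2); intros n hn.
    eapply Rle_lt_trans; [apply Cnorm_le_Re_Im|].
    specialize (H1 n ltac:(lia)); specialize (H2 n ltac:(lia)).
    unfold Rdist, Rminus in H1, H2; simpl; lra.
  - intros h; split; intros eps he; destruct (h eps he) as [N H]; exists N; intros n hn;
    specialize (H n hn).
    + eapply Rle_lt_trans; [|exact H]. apply (Cnorm_Re (u n - l)%cx).
    + eapply Rle_lt_trans; [|exact H]. apply (Cnorm_Im (u n - l)%cx).
Qed.

Lemma Cseq_cv_mul (u v : nat -> Cplx) (l m : Cplx) :
  Cseq_cv u l -> Cseq_cv v m -> Cseq_cv (fun n => u n * v n)%cx (l * m)%cx.
Proof.
  intros [h1 h2] [h3 h4]; split; simpl.
  - apply CV_minus; apply CV_mult; assumption.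
  - apply CV_plus; apply CV_mult; assumption.
Qed.

Lemma Cseq_cv_add (u v : nat -> Cplx) (l m : Cplx) :
  Cseq_cv u l -> Cseq_cv v m -> Cseq_cv (fun n => u n + v n)%cx (l + m)%cx.
Proof. intros [h1 h2] [h3 h4]; split; simpl; apply CV_plus; assumption. Qed.

Lemma Cseq_cv_const (c : Cplx) : Cseq_cv (fun _ => c) c.
Proof.
  apply Cseq_cv_norm; intros eps he; exists O; intros.
  replace (c - c)%cx with Czero by ring. unfold Czero; rewrite Cnorm_RtoC, Rabs_R0; exact he.
Qed.

Lemma Cseq_cv_squeeze (u : nat -> Cplx) (l : Cplx) (v : nat -> R) (N : nat) :
  (forall n, (N <= n)%nat -> Cnorm (u n - l)%cx <= v n) -> Un_cv v 0 -> Cseq_cv u l.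
Proof.
  intros h hv; apply Cseq_cv_norm; intros eps he.
  destruct (hv eps he) as [M hM]; exists (max N M); intros n hn.
  eapply Rle_lt_trans; [apply h; lia|].
  specialize (hM n ltac:(lia)); unfold Rdist in hM; rewrite Rminus_0_r in hM.
  eapply Rle_lt_trans; [apply Rle_abs|exact hM].
Qed.

Lemma Cseq_cv_norm_le (u : nat -> Cplx) (l : Cplx) (B : R) (N : nat) :
  (forall n, (N <= n)%nat -> Cnorm (u n) <= B) -> Cseq_cv u l -> Cnorm l <= B.
Proof.
  intros h hu; apply Rnot_lt_le; intros hB.
  destruct (proj1 (Cseq_cv_norm u l) hu (Cnorm l - B)) as [M hM]; [lra|].
  specialize (hM (max N M) ltac:(lia)); specialize (h (max N M) ltac:(lia)).
  pose proof (Cnorm_add (l - u (max N M))%cx (u (max N M))) as t.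
  rewrite (Cnorm_sub_sym l) in t.
  replace (l - u (max N M) + u (max N M))%cx with l in t by ring. lra.
Qed.

Lemma Cseq_cv_Cauchy (u : nat -> Cplx) :
  (forall eps, 0 < eps -> exists N, forall m n,
     (N <= n)%nat -> (n <= m)%nat -> Cnorm (u m - u n)%cx < eps) ->
  exists l, Cseq_cv u l.
Proof.
  intros h.
  assert (key : forall p : Cplx -> R, (forall z w, p (z - w)%cx = p z - p w) ->
     (forall z, Rabs (p z) <= Cnorm z) -> Cauchy_crit (fun n => p (u n))).
  { intros p hs hp eps he; destruct (h eps he) as [N hN]; exists N; intros n m hn hm.
    unfold Rdist; destruct (Nat.le_ge_cases n m).
    - rewrite Rabs_minus_sym, <- hs. eapply Rle_lt_trans; [apply hp|apply hN; lia].
    - rewrite <- hs. eapply Rle_lt_trans; [apply hp|apply hN; lia]. }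
  destruct (R_complete _ (key Re (fun _ _ => eq_refl) Cnorm_Re)) as [x hx].
  destruct (R_complete _ (key Im (fun _ _ => eq_refl) Cnorm_Im)) as [y hy].
  exists (mkC x y); split; assumption.
Qed.

Lemma Un_cv_inv_INR (C : R) : Un_cv (fun n => C / INR (S n)) 0.
Proof.
  apply is_lim_seq_Reals.
  replace (Finite 0) with (Rbar_mult C 0) by (simpl; f_equal; ring).
  apply is_lim_seq_scal_l.
  apply (is_lim_seq_incr_1 (fun n => / INR n)).
  apply (is_lim_seq_inv INR p_infty); [apply is_lim_seq_INR|discriminate].
Qed.

(** The right-hand side is [1 / (x (x + 1))]. The bound replaces the sum of inverse squares by a
    telescoping one. *)
Lemma inv_sq_telescope (x : R) : 0 < x -> / (x + 1) ^ 2 <= / x - / (x + 1).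
Proof.
  intros hx. replace (/ x - / (x + 1)) with (/ (x * (x + 1))) by (field; lra).
  apply Rinv_le_contravar; nra.
Qed.

(* [Cnorm (w n) * exp (K / n)] is nonincreasing, so [w] is bounded and its increments
   are dominated by a telescoping series. *)
Lemma infinite_product_cv (w : nat -> Cplx) (K : R) (N : nat) :
  (1 <= N)%nat -> 0 <= K ->
  (forall n, (N <= n)%nat ->
     Cnorm (w (S n) - w n)%cx <= Cnorm (w n) * (K * / (INR n + 1) ^ 2)) ->
  exists l, Cseq_cv w l.
Proof.
  intros hN hK h.
  assert (pos : forall n, (N <= n)%nat -> 0 < INR n) by (intros; apply lt_0_INR; lia).
  set (M := Cnorm (w N) * exp (K * / INR N)).
  assert (hM : forall n, (N <= n)%nat -> Cnorm (w n) * exp (K * / INR n) <= M).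
  { intros n hn; induction hn as [|n hn IH]; [apply Rle_refl|].
    eapply Rle_trans; [|exact IH].
    pose proof (pos n hn) as p.
    assert (h1 : Cnorm (w (S n)) <= Cnorm (w n) * exp (K * / (INR n + 1) ^ 2)).
    { pose proof (Cnorm_add (w (S n) - w n)%cx (w n)) as t.
      replace (w (S n) - w n + w n)%cx with (w (S n)) in t by ring.
      pose proof (h n hn). pose proof (Cnorm_pos (w n)).
      pose proof (exp_ineq1_le (K * / (INR n + 1) ^ 2)). nra. }
    rewrite S_INR.
    (* The exponent [K / n] is split: one part pays for the growth in a single step, and the rest is
       still at least [K / (n + 1)] by [inv_sq_telescope]. *)
    replace (Cnorm (w n) * exp (K * / INR n)) with
      (Cnorm (w n) * exp (K * / (INR n + 1) ^ 2) * exp (K * (/ INR n - / (INR n + 1) ^ 2))).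
    2: { rewrite Rmult_assoc, <- exp_plus; f_equal; f_equal; ring. }
    apply Rmult_le_compat; [apply Cnorm_pos|left; apply exp_pos|exact h1|].
    apply exp_le, Rmult_le_compat_l; [exact hK|].
    pose proof (inv_sq_telescope (INR n) p); lra. }
  assert (hB : forall n, (N <= n)%nat -> Cnorm (w n) <= M).
  { intros n hn; eapply Rle_trans; [|apply (hM n hn)].
    rewrite <- (Rmult_1_r (Cnorm (w n))) at 1.
    apply Rmult_le_compat_l; [apply Cnorm_pos|].
    rewrite <- exp_0; apply exp_le.
    apply Rmult_le_pos; [exact hK|left; apply Rinv_0_lt_compat, pos, hn]. }
  assert (M0 : 0 <= M) by (eapply Rle_trans; [apply Cnorm_pos|apply (hB N); lia]).
  assert (hd : forall n m, (N <= n)%nat -> (n <= m)%nat ->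
    Cnorm (w m - w n)%cx <= M * K * (/ INR n - / INR m)).
  { intros n m hn hm; induction hm as [|m hm IH].
    - replace (w n - w n)%cx with Czero by ring. unfold Czero; rewrite Cnorm_RtoC, Rabs_R0. lra.
    - replace (w (S m) - w n)%cx with ((w (S m) - w m) + (w m - w n))%cx by ring.
      eapply Rle_trans; [apply Cnorm_add|].
      pose proof (h m ltac:(lia)) as h1. pose proof (hB m ltac:(lia)) as h2.
      pose proof (inv_sq_telescope (INR m) (pos m ltac:(lia))) as h3.
      rewrite S_INR.
      assert (0 < / (INR m + 1) ^ 2)
        by (apply Rinv_0_lt_compat; pose proof (pos m ltac:(lia)); nra).
      assert (Cnorm (w m) * (K * / (INR m + 1) ^ 2) <= M * (K * (/ INR m - / (INR m + 1)))).
      { apply Rmult_le_compat; [apply Cnorm_pos| |exact h2|].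
        - apply Rmult_le_pos; lra.
        - apply Rmult_le_compat_l; assumption. }
      lra. }
  apply Cseq_cv_Cauchy; intros eps he.
  destruct (Un_cv_inv_INR (M * K) eps he) as [N' hN'].
  exists (S (max N N')); intros m n hn hm.
  eapply Rle_lt_trans; [apply hd; lia|].
  specialize (hN' (pred n) ltac:(lia)); replace (S (pred n)) with n in hN' by lia.
  unfold Rdist in hN'; rewrite Rminus_0_r in hN'.
  eapply Rle_lt_trans; [|exact hN'].
  eapply Rle_trans; [|apply Rle_abs]. unfold Rdiv.
  apply Rmult_le_compat_l; [apply Rmult_le_pos; assumption|].
  assert (0 < / INR m) by (apply Rinv_0_lt_compat, pos; lia). lra.
Qed.

(** Because [x^r <= 1] on (0,1]. The bound on [x^(r-1)] avoids a case distinction on the sign of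
    [r - 1]. *)
Lemma exp_ln_le_inv (x r : R) : 0 < x <= 1 -> 0 <= r -> exp ((r - 1) * ln x) <= / x.
Proof.
  intros hx hr.
  replace ((r - 1) * ln x) with (- ln x + r * ln x) by ring.
  rewrite exp_plus, exp_Ropp, exp_ln by lra.
  rewrite <- (Rmult_1_r (/ x)) at 2.
  apply Rmult_le_compat_l; [left; apply Rinv_0_lt_compat; lra|].
  rewrite <- exp_0; apply exp_le.
  assert (ln x <= 0) by (rewrite <- ln_1; apply ln_le; lra). nra.
Qed.

Lemma is_Cderive_affine (c d : Cplx) (x : R) : is_Cderive (fun s => c + d * RtoC s)%cx x d.
Proof. split; simpl; auto_derive; try exact I; ring. Qed.

(** The derivative of [(1 + z s) (1 - s)^z] is [- z (1 + z) s (1 - s)^(z-1)]. It vanishes at 0, so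
    the increment is quadratic in [h]. The constant 4 is the 2 of [Cderive_bound] times the bound 2
    for [1 / (1 - s)] on [0, 1/2]. *)
Lemma gauss_factor_bound (z : Cplx) (h : R) : 0 < Re z -> 0 <= h <= 1 / 2 ->
  Cnorm ((Cone + z * RtoC h) * Rcpow (1 - h) z - Cone)%cx
    <= 4 * (Cnorm z * Cnorm (Cone + z)%cx) * h ^ 2.
Proof.
  intros hz hh.
  set (f := fun s => ((Cone + z * RtoC s) * Rcpow (1 - s) z)%cx).
  set (f' := fun s => (- (z * (Cone + z)) * (RtoC s * Rcpow (1 - s) (z - Cone)))%cx).
  replace Cone with (f 0) at 2.
  2: { unfold f; rewrite Rminus_0_r, Rcpow_1l. fold Czero; ring. }
  replace (4 * (Cnorm z * Cnorm (Cone + z)%cx) * h ^ 2)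
    with (2 * (2 * (Cnorm z * Cnorm (Cone + z)%cx) * h * (h - 0))) by ring.
  apply (Cderive_bound f f'); [lra| |].
  - intros s hs.
    assert (hp : 0 < 1 - s) by lra.
    eapply is_Cderive_ext_l; [|apply is_Cderive_mul;
      [apply is_Cderive_affine|apply (is_Cderive_Rcpow (fun s => 1 - s) (-1));
        [auto_derive; [exact I|ring]|exact hp]]].
    unfold f'; rewrite !Rcpow_sub, Rcpow_1 by exact hp.
    replace (RtoC (-1)) with (- Cone)%cx by (apply Cplx_eq; simpl; ring).
    rewrite RtoC_sub. fold Cone. field.
    intros e; apply (f_equal Re) in e; simpl in e; lra.
  - intros s hs; unfold f'.
    rewrite Cnorm_mul, Cnorm_opp, !Cnorm_mul, Cnorm_RtoC, Cnorm_Rcpow, Rabs_pos_eq by lra.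
    replace (Re (z - Cone)%cx) with (Re z - 1) by reflexivity.
    pose proof (exp_ln_le_inv (1 - s) (Re z) ltac:(lra) ltac:(lra)) as e.
    assert (/ (1 - s) <= 2).
    { replace 2 with (/ (1 / 2)) by field. apply Rinv_le_contravar; lra. }
    pose proof (exp_pos ((Re z - 1) * ln (1 - s))).
    set (A := Cnorm z * Cnorm (Cone + z)%cx).
    assert (0 <= A) by (apply Rmult_le_pos; apply Cnorm_pos).
    set (E := exp _) in *.
    apply Rle_trans with (A * (h * 2)); [|lra].
    apply Rmult_le_compat_l; [assumption|]. apply Rmult_le_compat; lra.
Qed.

Lemma Cpos_add_INR (z : Cplx) (n : nat) : 0 < Re z -> (z + RtoC (INR n))%cx <> Czero.
Proof. intros hz; apply Cpos_neq0; simpl; pose proof (pos_INR n); lra. Qed.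

Lemma pochhammer_neq0 (z : Cplx) (n : nat) : 0 < Re z ->
  Cprod_nat (fun k => z + RtoC (INR k))%cx n <> Czero.
Proof.
  intros hz; induction n; [apply Cpos_add_INR, hz|].
  apply Cmul_neq0; [exact IHn|apply Cpos_add_INR, hz].
Qed.

Lemma RtoC_fact_neq0 (n : nat) : RtoC (INR (fact n)) <> Czero.
Proof. apply RtoC_neq0, INR_fact_neq_0. Qed.

Lemma RtoC_INR_S_neq0 (n : nat) : RtoC (INR (S n)) <> Czero.
Proof. apply RtoC_neq0, not_0_INR; discriminate. Qed.

Lemma gamma_seq_neq0 (z : Cplx) (n : nat) : 0 < Re z -> gamma_seq z n <> Czero.
Proof.
  intros hz h.
  assert (e : (RtoC (INR (fact n)) * Rcpow (INR n) z =
     gamma_seq z n * Cprod_nat (fun k => z + RtoC (INR k)) n)%cx)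
    by (unfold gamma_seq; field; apply pochhammer_neq0, hz).
  rewrite h in e.
  apply (Cmul_neq0 _ _ (RtoC_fact_neq0 n) (Rcpow_neq0 (INR n) z)). rewrite e; ring.
Qed.

Lemma RtoC_fact_S (n : nat) : RtoC (INR (fact (S n))) = (RtoC (INR (S n)) * RtoC (INR (fact n)))%cx.
Proof. rewrite fact_simpl, mult_INR, RtoC_mul; reflexivity. Qed.

(** With [h = 1 / (n + 1)] one has [n = (n + 1) (1 - h)] and [z + n + 1 = (n + 1) (1 + z h)]. Going
    from [n + 1] back to [n] puts the ratio in the form estimated by [gauss_factor_bound], without
    division. *)
Lemma gamma_seq_S (z : Cplx) (n : nat) : 0 < Re z -> (1 <= n)%nat ->
  gamma_seq z n = (gamma_seq z (S n) *
    ((Cone + z * RtoC (/ (INR n + 1))) * Rcpow (1 - / (INR n + 1)) z))%cx.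
Proof.
  intros hz hn.
  assert (hp : 0 < INR n) by (apply lt_0_INR; lia).
  assert (hi : 0 < 1 - / (INR n + 1)).
  { replace (1 - / (INR n + 1)) with (INR n / (INR n + 1)) by (field; lra).
    apply Rdiv_lt_0_compat; lra. }
  unfold gamma_seq; rewrite RtoC_fact_S.
  change (Cprod_nat (fun k => z + RtoC (INR k))%cx (S n))
    with (Cprod_nat (fun k => z + RtoC (INR k))%cx n * (z + RtoC (INR (S n))))%cx.
  replace (INR n) with (INR (S n) * (1 - / (INR n + 1))) at 1
    by (rewrite S_INR; field; lra).
  rewrite Rcpow_mult by (try exact hi; rewrite S_INR; lra).
  replace (/ (INR n + 1)) with (1 / INR (S n)) at 2 by (rewrite S_INR; field; lra).
  rewrite RtoC_div by (apply not_0_INR; discriminate). fold Cone.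
  field; repeat split.
  - apply RtoC_INR_S_neq0.
  - apply (Cpos_add_INR z (S n) hz).
  - apply pochhammer_neq0, hz.
Qed.

(** The sequence and its reciprocals both satisfy the increment bound of [infinite_product_cv]. Both
    converge, and their limits multiply to 1, so neither is zero. *)
Lemma gamma_seq_cv (z : Cplx) : 0 < Re z -> exists l, Cseq_cv (gamma_seq z) l /\ l <> Czero.
Proof.
  intros hz.
  set (c := fun n => ((Cone + z * RtoC (/ (INR n + 1))) * Rcpow (1 - / (INR n + 1)) z - Cone)%cx).
  set (K := 4 * (Cnorm z * Cnorm (Cone + z)%cx)).
  assert (hK : 0 <= K) by (apply Rmult_le_pos; [lra|apply Rmult_le_pos; apply Cnorm_pos]).
  assert (hc : forall n, (1 <= n)%nat -> Cnorm (c n) <= K * / (INR n + 1) ^ 2).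
  { intros n hn; unfold K. rewrite <- pow_inv. apply gauss_factor_bound; [exact hz|].
    assert (1 <= INR n) by (apply (le_INR 1 n), hn). split.
    - left; apply Rinv_0_lt_compat; lra.
    - unfold Rdiv; rewrite Rmult_1_l; apply Rinv_le_contravar; lra. }
  assert (hs : forall n, (1 <= n)%nat -> gamma_seq z n = (gamma_seq z (S n) * (Cone + c n))%cx).
  { intros n hn; rewrite (gamma_seq_S z n hz hn); unfold c. ring. }
  (* Beyond [2 * K] the correction [c n] is at most 1/2, so a step forward at most doubles the norm.
     This is why the constant for [gamma_seq] is [2 * K], while [K] suffices for the reciprocals,
     whose increment is exactly [c n] times the current term. *)
  destruct (INR_unbounded (2 * K)) as [N0 hN0].
  set (N := S N0).
  assert (hsmall : forall n, (N <= n)%nat -> Cnorm (c n) <= 1 / 2).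
  { intros n hn; eapply Rle_trans; [apply hc; unfold N in hn; lia|].
    assert (INR N0 <= INR n) by (apply le_INR; unfold N in hn; lia).
    pose proof (pos_INR n).
    apply Rmult_le_reg_r with ((INR n + 1) ^ 2); [nra|].
    rewrite Rmult_assoc, Rinv_l by nra. nra. }
  destruct (infinite_product_cv (gamma_seq z) (2 * K) N) as [l hl];
    [unfold N; lia|lra| |].
  { intros n hn.
    pose proof (hs n ltac:(unfold N in hn; lia)) as e.
    set (g := gamma_seq z n) in *; set (g' := gamma_seq z (S n)) in *.
    replace (g' - g)%cx with (- (g' * c n))%cx by (rewrite e; ring).
    rewrite Cnorm_opp, Cnorm_mul.
    assert (Cnorm g' <= 2 * Cnorm g).
    { pose proof (Cnorm_add g (- (g' * c n))%cx) as t.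
      replace (g + - (g' * c n))%cx with g' in t by (rewrite e; ring).
      rewrite Cnorm_opp, Cnorm_mul in t.
      pose proof (hsmall n hn); pose proof (Cnorm_pos g'). nra. }
    pose proof (hc n ltac:(unfold N in hn; lia)).
    replace (Cnorm g * (2 * K * / (INR n + 1) ^ 2))
      with (2 * Cnorm g * (K * / (INR n + 1) ^ 2)) by ring.
    apply Rmult_le_compat; try apply Cnorm_pos; assumption. }
  destruct (infinite_product_cv (fun n => Cinv (gamma_seq z n)) K N) as [m hm];
    [unfold N; lia|lra| |].
  { intros n hn.
    pose proof (hs n ltac:(unfold N in hn; lia)) as e.
    replace (Cinv (gamma_seq z (S n)) - Cinv (gamma_seq z n))%cx
      with (Cinv (gamma_seq z n) * c n)%cx.
    - rewrite Cnorm_mul. apply Rmult_le_compat_l; [apply Cnorm_pos|].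
      apply hc; unfold N in hn; lia.
    - assert (hne : (Cone + c n)%cx <> Czero).
      { intros h; apply (gamma_seq_neq0 z n hz); rewrite e, h; ring. }
      rewrite e; field; split; [exact hne|apply gamma_seq_neq0, hz]. }
  exists l; split; [exact hl|]. intros h0.
  assert (hlm : (l * m)%cx = Cone).
  { eapply Cseq_cv_unique; [apply (Cseq_cv_mul _ _ _ _ hl hm)|].
    eapply Cseq_cv_ext; [|apply Cseq_cv_const].
    intros n; simpl; field; apply gamma_seq_neq0, hz. }
  rewrite h0 in hlm. apply (f_equal Re) in hlm; simpl in hlm; lra.
Qed.

Lemma CGamma_spec (z : Cplx) : 0 < Re z -> Cseq_cv (gamma_seq z) (CGamma z).
Proof.
  intros hz; unfold CGamma; apply epsilon_spec.
  destruct (gamma_seq_cv z hz) as [l [hl _]]; exists l; exact hl.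
Qed.

Lemma CGamma_neq0 (z : Cplx) : 0 < Re z -> CGamma z <> Czero.
Proof.
  intros hz; destruct (gamma_seq_cv z hz) as [l [hl h0]].
  rewrite (Cseq_cv_unique _ _ _ (CGamma_spec z hz) hl); exact h0.
Qed.

Lemma Cprod_nat_S_INR (n : nat) :
  Cprod_nat (fun k => Cone + RtoC (INR k))%cx n = RtoC (INR (fact (S n))).
Proof.
  induction n as [|n IH]; [apply Cplx_eq; simpl; ring|].
  rewrite RtoC_fact_S, <- IH, (S_INR (S n)), RtoC_add; fold Cone.
  change (Cprod_nat (fun k => Cone + RtoC (INR k))%cx (S n))
    with (Cprod_nat (fun k => Cone + RtoC (INR k))%cx n * (Cone + RtoC (INR (S n))))%cx.
  ring.
Qed.

(** Here the n-th term of Gauss' product is [n / (n + 1)], at distance [1 / (n + 1)] from 1. *)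
Lemma CGamma_1 : CGamma Cone = Cone.
Proof.
  eapply Cseq_cv_unique; [apply CGamma_spec; simpl; lra|].
  eapply (Cseq_cv_squeeze _ _ (fun n => 1 / INR (S n)) 1); [|apply Un_cv_inv_INR].
  intros n hn.
  assert (hp : 0 < INR n) by (apply lt_0_INR; lia).
  assert (hs : INR (S n) <> 0) by (apply not_0_INR; discriminate).
  assert (e : (gamma_seq Cone n - Cone)%cx = RtoC (- (1 / INR (S n)))).
  { unfold gamma_seq. rewrite Cprod_nat_S_INR, RtoC_fact_S, Rcpow_1 by exact hp.
    replace (INR n) with (INR (S n) - 1) by (rewrite S_INR; ring).
    rewrite RtoC_opp, RtoC_div, RtoC_sub by exact hs. fold Cone.
    field; split; [apply RtoC_INR_S_neq0|apply RtoC_fact_neq0]. }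
  rewrite e, Cnorm_RtoC, Rabs_Ropp, Rabs_pos_eq; [lra|].
  apply Rdiv_le_0_compat; [lra|apply lt_0_INR; lia].
Qed.

(** * Improper integrals on (0,1) *)

Notation ends01 := (filter_prod (at_right 0) (at_left 1)).

Lemma ends01_intro (P : R * R -> Prop) :
  (forall a b, 0 < a -> a < b -> b < 1 -> P (a, b)) -> ends01 P.
Proof.
  intros h; apply (Filter_prod _ _ _ (fun a => 0 < a < 1 / 2) (fun b => 1 / 2 < b < 1)).
  - exists (mkposreal (1 / 2) ltac:(lra)); intros y hy h0.
    apply Rabs_lt_between' in hy; simpl in hy; lra.
  - exists (mkposreal (1 / 2) ltac:(lra)); intros y hy h0.
    apply Rabs_lt_between' in hy; simpl in hy; lra.
  - intros a b ha hb; apply h; lra.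
Qed.

Lemma at_right_0_intro (P : R -> Prop) : (forall u, 0 < u < 1 -> P u) -> at_right 0 P.
Proof.
  intros h; exists (mkposreal 1 ltac:(lra)); intros y hy h0.
  apply Rabs_lt_between' in hy; simpl in hy; apply h; lra.
Qed.

Lemma at_left_1_intro (P : R -> Prop) : (forall u, 0 < u < 1 -> P u) -> at_left 1 P.
Proof.
  intros h; exists (mkposreal 1 ltac:(lra)); intros y hy h0.
  apply Rabs_lt_between' in hy; simpl in hy; apply h; lra.
Qed.

Lemma RInt01_unique (f : R -> R) (l l' : R) :
  is_RInt_gen f (at_right 0) (at_left 1) l ->
  is_RInt_gen f (at_right 0) (at_left 1) l' -> l = l'.
Proof.
  intros h1 h2; rewrite <- (is_RInt_gen_unique f l h1); apply is_RInt_gen_unique, h2.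
Qed.

Lemma RInt01_ext (f g : R -> R) (l : R) :
  (forall u, 0 < u < 1 -> f u = g u) ->
  is_RInt_gen f (at_right 0) (at_left 1) l -> is_RInt_gen g (at_right 0) (at_left 1) l.
Proof.
  intros h; apply is_RInt_gen_ext, ends01_intro; intros a b ha hab hb u hu; simpl in hu.
  rewrite Rmin_left, Rmax_right in hu by lra. apply h; lra.
Qed.

Lemma RInt01_scal (k : R) (f : R -> R) (l : R) :
  is_RInt_gen f (at_right 0) (at_left 1) l ->
  is_RInt_gen (fun u => k * f u) (at_right 0) (at_left 1) (k * l).
Proof. intros h; exact (is_RInt_gen_scal f k l h). Qed.

Lemma RInt01_derive (F f : R -> R) (l0 l1 : R) :
  (forall u, 0 < u < 1 -> is_derive F u (f u)) ->
  (forall u, 0 < u < 1 -> continuous f u) ->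
  filterlim F (at_right 0) (locally l0) -> filterlim F (at_left 1) (locally l1) ->
  is_RInt_gen f (at_right 0) (at_left 1) (l1 - l0).
Proof.
  intros hd hc h0 h1.
  apply RInt01_ext with (Derive F); [intros u hu; apply is_derive_unique, hd, hu|].
  apply is_RInt_gen_Derive; try assumption; apply ends01_intro; intros a b ha hab hb u hu;
    simpl in hu; rewrite Rmin_left, Rmax_right in hu by lra.
  - exists (f u); apply hd; lra.
  - apply (continuous_ext_loc (Derive F) f); [|apply hc; lra].
    assert (hu01 : 0 < u < 1) by lra.
    exists (mkposreal (Rmin u (1 - u)) ltac:(apply Rmin_pos; lra)); intros y hy.
    apply Rabs_lt_between' in hy; simpl in hy.
    pose proof (Rmin_l u (1 - u)); pose proof (Rmin_r u (1 - u)).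
    symmetry; apply is_derive_unique, hd; lra.
Qed.

Lemma continuous01_ex_RInt (f : R -> R) (a b : R) :
  (forall u, 0 < u < 1 -> continuous f u) -> 0 < a < 1 -> 0 < b < 1 -> ex_RInt f a b.
Proof.
  intros hc ha hb; apply (ex_RInt_continuous (V := R_CompleteNormedModule)).
  intros u hu; apply hc; split.
  - eapply Rlt_le_trans; [|apply hu]. apply Rmin_glb_lt; lra.
  - eapply Rle_lt_trans; [apply hu|]. apply Rmax_lub_lt; lra.
Qed.

(** A majorant with a known primitive turns every estimate of an integral into an increment of [H].
    The absolute value on the right allows the ends in either order, as needed when two inner
    intervals are compared. *)
Lemma RInt_dominated_bound (H h f : R -> R) (a b : R) :
  (forall u, 0 < u < 1 -> is_derive H u (h u)) ->
  (forall u, 0 < u < 1 -> continuous h u) ->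
  (forall u, 0 < u < 1 -> continuous f u) -> (forall u, 0 < u < 1 -> Rabs (f u) <= h u) ->
  0 < a < 1 -> 0 < b < 1 -> Rabs (RInt f a b) <= Rabs (H b - H a).
Proof.
  intros dH ch hc hf.
  assert (key : forall a b, 0 < a < 1 -> 0 < b < 1 -> a <= b ->
    Rabs (RInt f a b) <= Rabs (H b - H a)).
  { clear a b; intros a b ha hb hab.
    eapply Rle_trans; [|apply Rle_abs].
    rewrite <- (is_RInt_unique h a b (H b - H a)).
    2: { apply (is_RInt_derive H h); intros u hu; rewrite Rmin_left, Rmax_right in hu by lra;
         [apply dH|apply ch]; lra. }
    eapply Rle_trans.
    - apply abs_RInt_le; [exact hab|]. apply continuous01_ex_RInt; assumption.
    - apply RInt_le; [exact hab| |apply continuous01_ex_RInt; assumption|].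
      + apply continuous01_ex_RInt; try assumption.
        intros u hu; apply (continuous_comp f Rabs); [apply hc, hu|apply continuous_Rabs].
      + intros u hu; apply hf; lra. }
  intros ha hb; destruct (Rle_dec a b) as [hab|hab]; [apply key; assumption|].
  rewrite <- (opp_RInt_swap f b a) by (apply continuous01_ex_RInt; assumption).
  unfold opp; simpl; rewrite Rabs_Ropp, Rabs_minus_sym. apply key; lra.
Qed.

(** Integrals over two inner intervals differ by at most the increments of [H] between corresponding
    ends, so Cauchy's criterion applies. The truncation error depends on [f] only through the
    majorant, which makes it uniform over families of integrands. *)
Lemma RInt01_dominated (H h f : R -> R) (l0 l1 : R) :
  (forall u, 0 < u < 1 -> is_derive H u (h u)) ->
  (forall u, 0 < u < 1 -> continuous h u) ->
  filterlim H (at_right 0) (locally l0) -> filterlim H (at_left 1) (locally l1) ->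
  (forall u, 0 < u < 1 -> continuous f u) -> (forall u, 0 < u < 1 -> Rabs (f u) <= h u) ->
  exists l, is_RInt_gen f (at_right 0) (at_left 1) l /\
    forall a b, 0 < a < 1 -> 0 < b < 1 ->
      Rabs (RInt f a b - l) <= Rabs (H a - l0) + Rabs (H b - l1).
Proof.
  intros dH ch H0 H1 hc hf.
  assert (diff : forall a b a' b', 0 < a < 1 -> 0 < b < 1 -> 0 < a' < 1 -> 0 < b' < 1 ->
    Rabs (RInt f a b - RInt f a' b') <= Rabs (H a - H a') + Rabs (H b - H b')).
  { intros a b a' b' ha hb ha' hb'.
    assert (ex : forall x y, 0 < x < 1 -> 0 < y < 1 -> ex_RInt f x y)
      by (intros; apply continuous01_ex_RInt; assumption).
    assert (e1 := RInt_Chasles f a a' b (ex _ _ ha ha') (ex _ _ ha' hb)).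
    assert (e2 := RInt_Chasles f a' b b' (ex _ _ ha' hb) (ex _ _ hb hb')).
    unfold plus in e1, e2; simpl in e1, e2.
    replace (RInt f a b - RInt f a' b') with (RInt f a a' + - RInt f b b') by lra.
    eapply Rle_trans; [apply Rabs_triang|]. rewrite Rabs_Ropp, (Rabs_minus_sym (H a)),
      (Rabs_minus_sym (H b)).
    apply Rplus_le_compat; apply (RInt_dominated_bound H h); assumption. }
  set (near := fun eps (ab : R * R) =>
    (0 < fst ab < 1 /\ 0 < snd ab < 1) /\
    Rabs (H (fst ab) - l0) < eps /\ Rabs (H (snd ab) - l1) < eps).
  assert (near_ends : forall eps, 0 < eps -> ends01 (near eps)).
  { intros eps he. apply filter_and; [apply ends01_intro; simpl; intros; lra|].
    apply (Filter_prod _ _ _ (fun a => Rabs (H a - l0) < eps) (fun b => Rabs (H b - l1) < eps)).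
    - apply (H0 (fun y => Rabs (y - l0) < eps)). exists (mkposreal eps he); intros y hy; exact hy.
    - apply (H1 (fun y => Rabs (y - l1) < eps)). exists (mkposreal eps he); intros y hy; exact hy.
    - intros; simpl; split; assumption. }
  destruct (proj1 (filterlim_locally_cauchy (F := ends01) (U := R_CompleteSpace)
     (fun ab => RInt f (fst ab) (snd ab)))) as [l hl].
  { intros eps. exists (near (eps / 4)); split.
    - apply near_ends; destruct eps; simpl; lra.
    - intros [a b] [a' b'] [[ha hb] [h1 h2]] [[ha' hb'] [h3 h4]]; simpl in *.
      change (Rabs (RInt f a' b' - RInt f a b) < eps).
      eapply Rle_lt_trans; [apply diff; assumption|].
      apply Rabs_def2 in h1, h2, h3, h4. destruct h1, h2, h3, h4.
      assert (Rabs (H a' - H a) < eps / 2) by (apply Rabs_def1; lra).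
      assert (Rabs (H b' - H b) < eps / 2) by (apply Rabs_def1; lra). lra. }
  exists l; split.
  - apply (filterlimi_lim_ext_loc (fun ab => RInt f (fst ab) (snd ab))); [|exact hl].
    apply ends01_intro; intros a b ha hab hb; simpl.
    apply (RInt_correct (V := R_CompleteNormedModule)), continuous01_ex_RInt; try assumption; lra.
  (* Comparison with an interval so close to (0,1) that [H] at each end, and the integral itself,
     are within [eps / 3] of their limits. *)
  - intros a b ha hb. apply le_epsilon; intros eps he.
    assert (hx : ends01 (fun ab => near (eps / 3) ab /\
              Rabs (RInt f (fst ab) (snd ab) - l) < eps / 3)).
    { apply filter_and; [apply near_ends; lra|].
      apply (hl (fun y => Rabs (y - l) < eps / 3)).
      exists (mkposreal (eps / 3) ltac:(lra)); intros y hy; exact hy. }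
    destruct (filter_ex _ hx) as [[a' b'] [[[ha' hb'] [h3 h4]] h5]]; simpl in *.
    replace (RInt f a b - l) with ((RInt f a b - RInt f a' b') + (RInt f a' b' - l)) by ring.
    eapply Rle_trans; [apply Rabs_triang|].
    pose proof (diff a b a' b' ha hb ha' hb') as h6.
    assert (Rabs (H a - H a') <= Rabs (H a - l0) + Rabs (H a' - l0)).
    { replace (H a - H a') with ((H a - l0) + - (H a' - l0)) by ring.
      eapply Rle_trans; [apply Rabs_triang|]. rewrite Rabs_Ropp; lra. }
    assert (Rabs (H b - H b') <= Rabs (H b - l1) + Rabs (H b' - l1)).
    { replace (H b - H b') with ((H b - l1) + - (H b' - l1)) by ring.
      eapply Rle_trans; [apply Rabs_triang|]. rewrite Rabs_Ropp; lra. }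
    lra.
Qed.

Definition CInt (f : R -> Cplx) (a b : R) : Cplx :=
  mkC (RInt (fun u => Re (f u)) a b) (RInt (fun u => Im (f u)) a b).

Definition is_CInt01 (f : R -> Cplx) (v : Cplx) : Prop :=
  is_RInt_gen (fun u => Re (f u)) (at_right 0) (at_left 1) (Re v) /\
  is_RInt_gen (fun u => Im (f u)) (at_right 0) (at_left 1) (Im v).

Definition Ccontinuous01 (f : R -> Cplx) : Prop := forall u, 0 < u < 1 -> Ccontinuous f u.

Lemma is_CInt01_unique (f : R -> Cplx) (v w : Cplx) :
  is_CInt01 f v -> is_CInt01 f w -> v = w.
Proof. intros [h1 h2] [h3 h4]; apply Cplx_eq; eapply RInt01_unique; eassumption. Qed.

Lemma is_CInt01_ext (f g : R -> Cplx) (v : Cplx) :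
  (forall u, 0 < u < 1 -> f u = g u) -> is_CInt01 f v -> is_CInt01 g v.
Proof.
  intros e [h1 h2]; split; (eapply RInt01_ext; [|eassumption]);
  intros u hu; simpl; rewrite (e u hu); reflexivity.
Qed.

Lemma is_CInt01_add (f g : R -> Cplx) (v w : Cplx) :
  is_CInt01 f v -> is_CInt01 g w -> is_CInt01 (fun u => f u + g u)%cx (v + w)%cx.
Proof.
  intros [h1 h2] [h3 h4]; split; simpl.
  - apply (is_RInt_gen_plus (fun u => Re (f u)) (fun u => Re (g u))); assumption.
  - apply (is_RInt_gen_plus (fun u => Im (f u)) (fun u => Im (g u))); assumption.
Qed.

Lemma is_CInt01_scal (c : Cplx) (f : R -> Cplx) (v : Cplx) :
  is_CInt01 f v -> is_CInt01 (fun u => c * f u)%cx (c * v)%cx.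
Proof.
  intros [h1 h2]; split; simpl.
  - apply (is_RInt_gen_minus (fun u => Re c * Re (f u)) (fun u => Im c * Im (f u)));
    apply RInt01_scal; assumption.
  - apply (is_RInt_gen_plus (fun u => Re c * Im (f u)) (fun u => Im c * Re (f u)));
    apply RInt01_scal; assumption.
Qed.

Lemma is_CInt01_derive (F f : R -> Cplx) (l0 l1 : Cplx) :
  (forall u, 0 < u < 1 -> is_Cderive F u (f u)) -> Ccontinuous01 f ->
  filterlim (fun u => Re (F u)) (at_right 0) (locally (Re l0)) ->
  filterlim (fun u => Im (F u)) (at_right 0) (locally (Im l0)) ->
  filterlim (fun u => Re (F u)) (at_left 1) (locally (Re l1)) ->
  filterlim (fun u => Im (F u)) (at_left 1) (locally (Im l1)) ->
  is_CInt01 f (l1 - l0)%cx.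
Proof.
  intros hd hc r0 i0 r1 i1; split; simpl.
  - apply (RInt01_derive (fun u => Re (F u))); try assumption; intros u hu;
      [apply hd, hu|apply hc, hu].
  - apply (RInt01_derive (fun u => Im (F u))); try assumption; intros u hu;
      [apply hd, hu|apply hc, hu].
Qed.

Lemma RInt01_le (f g : R -> R) (l m : R) :
  (forall u, 0 < u < 1 -> Rabs (f u) <= g u) ->
  is_RInt_gen f (at_right 0) (at_left 1) l ->
  is_RInt_gen g (at_right 0) (at_left 1) m -> Rabs l <= m.
Proof.
  intros h; apply (RInt_gen_norm (V := R_CompleteNormedModule) f g).
  - apply ends01_intro; simpl; intros; lra.
  - apply ends01_intro; simpl; intros a b ha hab hb u hu. apply h; lra.
Qed.

Lemma is_CInt01_norm_le (f : R -> Cplx) (g : R -> R) (v : Cplx) (m : R) :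
  (forall u, 0 < u < 1 -> Cnorm (f u) <= g u) ->
  is_CInt01 f v -> is_RInt_gen g (at_right 0) (at_left 1) m -> Cnorm v <= 2 * m.
Proof.
  intros h [h1 h2] hg.
  eapply Rle_trans; [apply Cnorm_le_Re_Im|].
  assert (Rabs (Re v) <= m).
  { eapply RInt01_le; [|exact h1|exact hg]. intros u hu.
    eapply Rle_trans; [apply Cnorm_Re|apply h, hu]. }
  assert (Rabs (Im v) <= m).
  { eapply RInt01_le; [|exact h2|exact hg]. intros u hu.
    eapply Rle_trans; [apply Cnorm_Im|apply h, hu]. }
  lra.
Qed.

Lemma is_CInt01_dominated (H h : R -> R) (l0 l1 : R) (f : R -> Cplx) :
  (forall u, 0 < u < 1 -> is_derive H u (h u)) ->
  (forall u, 0 < u < 1 -> continuous h u) ->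
  filterlim H (at_right 0) (locally l0) -> filterlim H (at_left 1) (locally l1) ->
  Ccontinuous01 f -> (forall u, 0 < u < 1 -> Cnorm (f u) <= h u) ->
  exists v, is_CInt01 f v /\
    forall a b, 0 < a < 1 -> 0 < b < 1 ->
      Cnorm (CInt f a b - v)%cx <= 2 * (Rabs (H a - l0) + Rabs (H b - l1)).
Proof.
  intros dH ch H0 H1 hc hf.
  destruct (RInt01_dominated H h (fun u => Re (f u)) l0 l1 dH ch H0 H1) as [x [hx1 hx2]].
  { intros u hu; apply hc, hu. }
  { intros u hu; eapply Rle_trans; [apply Cnorm_Re|apply hf, hu]. }
  destruct (RInt01_dominated H h (fun u => Im (f u)) l0 l1 dH ch H0 H1) as [y [hy1 hy2]].
  { intros u hu; apply hc, hu. }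
  { intros u hu; eapply Rle_trans; [apply Cnorm_Im|apply hf, hu]. }
  exists (mkC x y); split; [split; assumption|].
  intros a b ha hb. eapply Rle_trans; [apply Cnorm_le_Re_Im|]; simpl.
  pose proof (hx2 a b ha hb); pose proof (hy2 a b ha hb).
  unfold Rminus in *; lra.
Qed.

Lemma Ccontinuous01_ex_RInt (f : R -> Cplx) (a b : R) :
  Ccontinuous01 f -> 0 < a < 1 -> 0 < b < 1 ->
  ex_RInt (fun u => Re (f u)) a b /\ ex_RInt (fun u => Im (f u)) a b.
Proof.
  intros hc ha hb; split; apply continuous01_ex_RInt; try assumption;
  intros u hu; apply hc, hu.
Qed.

Lemma CInt_add (f g : R -> Cplx) (a b : R) :
  Ccontinuous01 f -> Ccontinuous01 g -> 0 < a < 1 -> 0 < b < 1 ->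
  CInt (fun u => f u + g u)%cx a b = (CInt f a b + CInt g a b)%cx.
Proof.
  intros hf hg ha hb.
  destruct (Ccontinuous01_ex_RInt f a b hf ha hb).
  destruct (Ccontinuous01_ex_RInt g a b hg ha hb).
  apply Cplx_eq; simpl.
  - apply (RInt_plus (fun u => Re (f u)) (fun u => Re (g u))); assumption.
  - apply (RInt_plus (fun u => Im (f u)) (fun u => Im (g u))); assumption.
Qed.

Lemma CInt_scal (c : Cplx) (f : R -> Cplx) (a b : R) :
  Ccontinuous01 f -> 0 < a < 1 -> 0 < b < 1 ->
  CInt (fun u => c * f u)%cx a b = (c * CInt f a b)%cx.
Proof.
  intros hf ha hb.
  destruct (Ccontinuous01_ex_RInt f a b hf ha hb) as [h1 h2].
  assert (s : forall k g, ex_RInt g a b -> is_RInt (fun u => k * g u) a b (k * RInt g a b)).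
  { intros k g hg; apply (is_RInt_scal g); apply (RInt_correct g), hg. }
  apply Cplx_eq; simpl; apply is_RInt_unique.
  - apply (is_RInt_minus (fun u => Re c * Re (f u)) (fun u => Im c * Im (f u)));
    apply (s _ (fun u => _ (f u))); assumption.
  - apply (is_RInt_plus (fun u => Re c * Im (f u)) (fun u => Im c * Re (f u)));
    apply (s _ (fun u => _ (f u))); assumption.
Qed.

Lemma CInt_norm_le (H h : R -> R) (f : R -> Cplx) (a b : R) :
  (forall u, 0 < u < 1 -> is_derive H u (h u)) ->
  (forall u, 0 < u < 1 -> continuous h u) ->
  Ccontinuous01 f -> (forall u, 0 < u < 1 -> Cnorm (f u) <= h u) ->
  0 < a < 1 -> 0 < b < 1 -> Cnorm (CInt f a b) <= 2 * Rabs (H b - H a).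
Proof.
  intros dH ch hc hf ha hb. eapply Rle_trans; [apply Cnorm_le_Re_Im|]; simpl.
  pose proof (RInt_dominated_bound H h (fun u => Re (f u)) a b dH ch
    (fun u hu => proj1 (hc u hu))
    (fun u hu => Rle_trans _ _ _ (Cnorm_Re _) (hf u hu)) ha hb).
  pose proof (RInt_dominated_bound H h (fun u => Im (f u)) a b dH ch
    (fun u hu => proj2 (hc u hu))
    (fun u hu => Rle_trans _ _ _ (Cnorm_Im _) (hf u hu)) ha hb).
  lra.
Qed.

(** * The Beta integral *)

Lemma filterlim_at_right_0 (f : R -> R) :
  continuous f 0 -> filterlim f (at_right 0) (locally (f 0)).
Proof. intros h P hP; apply (filter_le_within (F := locally 0) _ _ (h P hP)). Qed.

Lemma filterlim_at_left_1 (f : R -> R) :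
  continuous f 1 -> filterlim f (at_left 1) (locally (f 1)).
Proof. intros h P hP; apply (filter_le_within (F := locally 1) _ _ (h P hP)). Qed.

Lemma filterlim_one_sub_at_left_1 : filterlim (fun u => 1 - u) (at_left 1) (at_right 0).
Proof.
  intros P [d hd]; exists d; intros u hu h1; apply hd; [|lra].
  change (Rabs (u - 1) < d) in hu. change (Rabs (1 - u - 0) < d).
  rewrite Rabs_minus_sym in hu. rewrite Rminus_0_r; exact hu.
Qed.

Lemma filterlim_one_sub_at_right_0 : filterlim (fun u => 1 - u) (at_right 0) (at_left 1).
Proof.
  intros P [d hd]; exists d; intros u hu h1; apply hd; [|lra].
  change (Rabs (u - 0) < d) in hu. change (Rabs (1 - u - 1) < d).
  rewrite Rabs_minus_sym. replace (1 - (1 - u)) with (u - 0) by ring. exact hu.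
Qed.

Lemma filterlim_power_at_right_0 (r : R) : 0 < r ->
  filterlim (fun u => exp (r * ln u)) (at_right 0) (locally 0).
Proof.
  intros hr P [eps hP].
  (* The radius is [eps^(1/r)]. *)
  exists (mkposreal (exp (ln eps / r)) (exp_pos _)); intros u hu h0.
  change (Rabs (u - 0) < exp (ln eps / r)) in hu.
  rewrite Rminus_0_r, Rabs_pos_eq in hu by lra.
  apply hP. change (Rabs (exp (r * ln u) - 0) < eps).
  rewrite Rminus_0_r, Rabs_pos_eq by (left; apply exp_pos).
  rewrite <- (exp_ln eps) by apply cond_pos. apply exp_increasing.
  apply ln_increasing in hu; [|exact h0]. rewrite ln_exp in hu.
  apply (Rmult_lt_compat_l r) in hu; [|exact hr].
  replace (r * (ln eps / r)) with (ln eps) in hu by (field; lra). exact hu.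
Qed.

Lemma filterlim_power_at_left_1 (r : R) :
  filterlim (fun u => exp (r * ln u)) (at_left 1) (locally 1).
Proof.
  replace 1 with (exp (r * ln 1)) at 2 by (rewrite ln_1, Rmult_0_r; apply exp_0).
  apply (filterlim_at_left_1 (fun u => exp (r * ln u))).
  apply is_derive_continuous with (r * exp (r * ln 1) / 1).
  auto_derive; [lra|field].
Qed.

Lemma filterlim_squeeze0 (F : (R -> Prop) -> Prop) {FF : Filter F} (f g : R -> R) :
  F (fun u => Rabs (f u) <= g u) -> filterlim g F (locally 0) -> filterlim f F (locally 0).
Proof.
  intros h hg P [eps hP].
  assert (k : F (fun u => Rabs (g u - 0) < eps)).
  { apply (hg (fun y => Rabs (y - 0) < eps)). exists eps; intros y hy; exact hy. }
  unfold filtermap. generalize (filter_and _ _ h k). apply filter_imp.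
  intros u [h1 h2]. apply hP. change (Rabs (f u - 0) < eps).
  rewrite Rminus_0_r in *. eapply Rle_lt_trans; [exact h1|].
  eapply Rle_lt_trans; [apply Rle_abs|exact h2].
Qed.

Definition beta_fun (p q : Cplx) (u : R) : Cplx :=
  (Rcpow u (p - Cone) * Rcpow (1 - u) (q - Cone))%cx.

Lemma Ccontinuous01_beta_fun (p q : Cplx) : Ccontinuous01 (beta_fun p q).
Proof.
  intros u hu; apply Ccontinuous_mul.
  - apply (Ccontinuous_Rcpow (fun u => u)); [apply continuous_id|lra].
  - apply (Ccontinuous_Rcpow (fun u => 1 - u)); [|lra].
    apply is_derive_continuous with (-1); auto_derive; [exact I|ring].
Qed.

Lemma Cnorm_beta_fun (p q : Cplx) (u : R) :
  Cnorm (beta_fun p q u) = exp ((Re p - 1) * ln u) * exp ((Re q - 1) * ln (1 - u)).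
Proof. unfold beta_fun; rewrite Cnorm_mul, !Cnorm_Rcpow; reflexivity. Qed.

(** The singularities at 0 and 1 are separated into a sum, whose primitive is elementary. The factor
    2 bounds the other power on the half of (0,1) where it is regular. *)
Definition beta_majorant (r s u : R) : R :=
  2 * exp ((r - 1) * ln u) + 2 * exp ((s - 1) * ln (1 - u)).

Definition beta_primitive (r s u : R) : R :=
  2 / r * exp (r * ln u) - 2 / s * exp (s * ln (1 - u)).

Lemma is_derive_beta_primitive (r s u : R) : 0 < r -> 0 < s -> 0 < u < 1 ->
  is_derive (beta_primitive r s) u (beta_majorant r s u).
Proof.
  intros hr hs hu; unfold beta_primitive, beta_majorant. auto_derive; [lra|].
  replace ((r - 1) * ln u) with (r * ln u + - ln u) by ring.
  replace ((s - 1) * ln (1 - u)) with (s * ln (1 - u) + - ln (1 - u)) by ring.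
  replace (1 + - u) with (1 - u) by ring.
  rewrite !exp_plus, !exp_Ropp, !exp_ln by lra. field; lra.
Qed.

Lemma continuous_beta_majorant (r s u : R) : 0 < u < 1 -> continuous (beta_majorant r s) u.
Proof.
  intros hu; eapply is_derive_continuous; unfold beta_majorant; auto_derive; [lra|reflexivity].
Qed.

Lemma filterlim_lin (F : (R -> Prop) -> Prop) {FF : Filter F} (f g : R -> R) (c d l m : R) :
  filterlim f F (locally l) -> filterlim g F (locally m) ->
  filterlim (fun u => c * f u + d * g u) F (locally (c * l + d * m)).
Proof.
  intros hf hg.
  assert (hc : forall k h n, filterlim h F (locally n) ->
    filterlim (fun u => k * h u) F (locally (k * n))).
  { intros k h n hh; apply (filterlim_comp R R R h (fun y => k * y) F (locally n) _ hh).
    exact (filterlim_scal_r (K := R_AbsRing) (V := R_NormedModule) k n). }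
  apply (filterlim_comp_2 (fun u => c * f u) (fun u => d * g u) Rplus (hc c f l hf) (hc d g m hg)).
  exact (filterlim_plus (K := R_AbsRing) (V := R_NormedModule) (c * l) (d * m)).
Qed.

Lemma beta_primitive_at_0 (r s : R) : 0 < r ->
  filterlim (beta_primitive r s) (at_right 0) (locally (- (2 / s))).
Proof.
  intros hr. replace (- (2 / s)) with (2 / r * 0 + - (2 / s) * 1) by ring.
  apply filterlim_ext with (fun u => 2 / r * exp (r * ln u) + - (2 / s) * exp (s * ln (1 - u)));
    [intros u; unfold beta_primitive; ring|].
  apply (filterlim_lin (at_right 0)); [apply filterlim_power_at_right_0, hr|].
  apply (filterlim_comp R R R (fun u => 1 - u) (fun u => exp (s * ln u)) _ (at_left 1));
    [apply filterlim_one_sub_at_right_0|apply filterlim_power_at_left_1].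
Qed.

Lemma beta_primitive_at_1 (r s : R) : 0 < s ->
  filterlim (beta_primitive r s) (at_left 1) (locally (2 / r)).
Proof.
  intros hs. replace (2 / r) with (2 / r * 1 + - (2 / s) * 0) by ring.
  apply filterlim_ext with (fun u => 2 / r * exp (r * ln u) + - (2 / s) * exp (s * ln (1 - u)));
    [intros u; unfold beta_primitive; ring|].
  apply (filterlim_lin (at_left 1)); [apply filterlim_power_at_left_1|].
  apply (filterlim_comp R R R (fun u => 1 - u) (fun u => exp (s * ln u)) _ (at_right 0));
    [apply filterlim_one_sub_at_left_1|apply filterlim_power_at_right_0, hs].
Qed.

Lemma Cnorm_beta_fun_le (p q : Cplx) (u : R) : 0 < Re p -> 0 < Re q -> 0 < u < 1 ->
  Cnorm (beta_fun p q u) <= beta_majorant (Re p) (Re q) u.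
Proof.
  intros hp hq hu; rewrite Cnorm_beta_fun; unfold beta_majorant.
  assert (e1 := exp_ln_le_inv u (Re p) ltac:(lra) ltac:(lra)).
  assert (e2 := exp_ln_le_inv (1 - u) (Re q) ltac:(lra) ltac:(lra)).
  assert (p1 := exp_pos ((Re p - 1) * ln u)).
  assert (p2 := exp_pos ((Re q - 1) * ln (1 - u))).
  set (A := exp _) in *; set (B := exp _) in *.
  (* On the left half [(1 - u)^(s-1) <= 1 / (1 - u) <= 2], on the right half
     [u^(r-1) <= 1 / u <= 2]; each case uses one summand of the majorant. *)
  destruct (Rle_dec u (1 / 2)) as [h|h].
  - assert (/ (1 - u) <= 2)
      by (replace 2 with (/ (1 / 2)) by field; apply Rinv_le_contravar; lra). nra.
  - assert (/ u <= 2)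
      by (replace 2 with (/ (1 / 2)) by field; apply Rinv_le_contravar; lra). nra.
Qed.

Definition Beta (p q : Cplx) : Cplx := epsilon C_inhabited (is_CInt01 (beta_fun p q)).

Lemma Beta_spec (p q : Cplx) : 0 < Re p -> 0 < Re q -> is_CInt01 (beta_fun p q) (Beta p q).
Proof.
  intros hp hq; unfold Beta; apply epsilon_spec.
  destruct (is_CInt01_dominated (beta_primitive (Re p) (Re q)) (beta_majorant (Re p) (Re q))
    (- (2 / Re q)) (2 / Re p) (beta_fun p q)) as [v [hv _]].
  - intros; apply is_derive_beta_primitive; assumption.
  - intros; apply continuous_beta_majorant; assumption.
  - apply beta_primitive_at_0, hp.
  - apply beta_primitive_at_1, hq.
  - apply Ccontinuous01_beta_fun.
  - intros; apply Cnorm_beta_fun_le; assumption.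
  - exists v; exact hv.
Qed.

(** [(1 - u) + u = 1] under the integral sign. *)
Lemma Beta_split (p q : Cplx) : 0 < Re p -> 0 < Re q ->
  (Beta p (q + Cone) + Beta (p + Cone) q)%cx = Beta p q.
Proof.
  intros hp hq.
  eapply is_CInt01_unique; [|apply Beta_spec; assumption].
  eapply is_CInt01_ext; [|apply is_CInt01_add; apply Beta_spec; simpl; lra].
  intros u hu; unfold beta_fun.
  replace (q + Cone - Cone)%cx with (q - Cone + Cone)%cx by ring.
  replace (p + Cone - Cone)%cx with (p - Cone + Cone)%cx by ring.
  rewrite !Rcpow_add, !Rcpow_1 by lra. rewrite RtoC_sub. fold Cone. ring.
Qed.

Lemma filterlim_Cnorm_squeeze (F : (R -> Prop) -> Prop) {FF : Filter F} (f : R -> Cplx) (g : R -> R) :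
  F (fun u => Cnorm (f u) <= g u) -> filterlim g F (locally 0) ->
  filterlim (fun u => Re (f u)) F (locally 0) /\ filterlim (fun u => Im (f u)) F (locally 0).
Proof.
  intros h hg; split; (apply (filterlim_squeeze0 F) with g; [| exact hg]);
  revert h; apply filter_imp; intros u hu; (eapply Rle_trans; [|exact hu]);
  [apply Cnorm_Re|apply Cnorm_Im].
Qed.

Lemma exp_mul_ln_le_1 (x r : R) : 0 < x <= 1 -> 0 <= r -> exp (r * ln x) <= 1.
Proof.
  intros hx hr; rewrite <- exp_0; apply exp_le.
  assert (ln x <= 0) by (rewrite <- ln_1; apply ln_le; lra). nra.
Qed.

(* Integration of the derivative of [u^p (1-u)^q], which vanishes at both ends. *)
Lemma Beta_by_parts (p q : Cplx) : 0 < Re p -> 0 < Re q ->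
  (p * Beta p (q + Cone))%cx = (q * Beta (p + Cone) q)%cx.
Proof.
  intros hp hq.
  set (F := fun u => (Rcpow u p * Rcpow (1 - u) q)%cx).
  assert (hF : forall u, 0 < u < 1 -> Cnorm (F u) <= exp (Re p * ln u) /\
    Cnorm (F u) <= exp (Re q * ln (1 - u))).
  { intros u hu; unfold F; rewrite Cnorm_mul, !Cnorm_Rcpow.
    pose proof (exp_mul_ln_le_1 u (Re p) ltac:(lra) ltac:(lra)).
    pose proof (exp_mul_ln_le_1 (1 - u) (Re q) ltac:(lra) ltac:(lra)).
    pose proof (exp_pos (Re p * ln u)). pose proof (exp_pos (Re q * ln (1 - u))).
    set (A := exp (Re p * ln u)) in *; set (B := exp _) in *. split; nra. }
  destruct (filterlim_Cnorm_squeeze (at_right 0) F (fun u => exp (Re p * ln u))) as [a0 b0];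
    [apply at_right_0_intro; intros; apply hF; assumption|apply filterlim_power_at_right_0, hp|].
  destruct (filterlim_Cnorm_squeeze (at_left 1) F (fun u => exp (Re q * ln (1 - u)))) as [a1 b1];
    [apply at_left_1_intro; intros; apply hF; assumption
    |apply (filterlim_comp R R R (fun u => 1 - u) (fun u => exp (Re q * ln u)) _ (at_right 0));
     [apply filterlim_one_sub_at_left_1|apply filterlim_power_at_right_0, hq]|].
  set (f := fun u => (p * beta_fun p (q + Cone) u + (- q) * beta_fun (p + Cone) q u)%cx).
  assert (h1 : is_CInt01 f (Czero - Czero)%cx).
  { apply is_CInt01_derive with F; try assumption.
    - intros u hu.
      eapply is_Cderive_ext_l; [|apply is_Cderive_mul;
       [apply (is_Cderive_Rcpow (fun t => t) 1); [apply (is_derive_id (K := R_AbsRing))|lra]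
       |apply (is_Cderive_Rcpow (fun t => 1 - t) (-1)); [auto_derive; [exact I|ring]|lra]]].
      unfold f, beta_fun.
      replace (q + Cone - Cone)%cx with q by ring.
      replace (p + Cone - Cone)%cx with p by ring.
      replace (RtoC (-1)) with (- Cone)%cx by (apply Cplx_eq; simpl; ring).
      fold Cone. ring.
    - intros u hu; apply Ccontinuous_add; apply Ccontinuous_mul;
        (apply Ccontinuous_const || (apply Ccontinuous01_beta_fun; exact hu)). }
  assert (h2 : is_CInt01 f (p * Beta p (q + Cone) + (- q) * Beta (p + Cone) q)%cx)
    by (apply is_CInt01_add; apply is_CInt01_scal, Beta_spec; simpl; lra).
  pose proof (is_CInt01_unique _ _ _ h2 h1) as e.
  replace (p * Beta p (q + Cone))%cx with
    ((p * Beta p (q + Cone) + (- q) * Beta (p + Cone) q) + q * Beta (p + Cone) q)%cx by ring.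
  rewrite e; ring.
Qed.

(** Multiplying [Beta_split] by [q] and replacing [q B(p+1, q)] by [p B(p, q+1)] through integration
    by parts gives [(p + q) B(p, q+1) = q B(p, q)]. *)
Lemma Beta_succ_r (p q : Cplx) : 0 < Re p -> 0 < Re q ->
  Beta p (q + Cone)%cx = (q / (p + q) * Beta p q)%cx.
Proof.
  intros hp hq.
  assert (hpq : (p + q)%cx <> Czero) by (apply Cpos_neq0; simpl; lra).
  assert (e : ((p + q) * Beta p (q + Cone) = q * Beta p q)%cx).
  { rewrite <- (Beta_split p q hp hq).
    replace ((p + q) * Beta p (q + Cone))%cx
      with (p * Beta p (q + Cone) + q * Beta p (q + Cone))%cx by ring.
    rewrite (Beta_by_parts p q hp hq); ring. }
  replace (q / (p + q) * Beta p q)%cx with ((q * Beta p q) / (p + q))%cx by (field; exact hpq).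
  rewrite <- e; field; exact hpq.
Qed.

Lemma Beta_succ_l (p q : Cplx) : 0 < Re p -> 0 < Re q ->
  Beta (p + Cone)%cx q = (p / (p + q) * Beta p q)%cx.
Proof.
  intros hp hq.
  assert (hpq : (p + q)%cx <> Czero) by (apply Cpos_neq0; simpl; lra).
  replace (Beta (p + Cone)%cx q)
    with ((Beta p (q + Cone) + Beta (p + Cone) q) - Beta p (q + Cone))%cx by ring.
  rewrite (Beta_split p q hp hq), (Beta_succ_r p q hp hq); field; exact hpq.
Qed.

Lemma Beta_1_r (p : Cplx) : 0 < Re p -> Beta p Cone = Cinv p.
Proof.
  intros hp.
  assert (hp0 : p <> Czero) by (apply Cpos_neq0, hp).
  set (F := fun u => Rcpow u p).
  destruct (filterlim_Cnorm_squeeze (at_right 0) F (fun u => exp (Re p * ln u))) as [a0 b0];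
    [apply at_right_0_intro; intros; unfold F; rewrite Cnorm_Rcpow; apply Rle_refl
    |apply filterlim_power_at_right_0, hp|].
  assert (hd : forall u, 0 < u -> is_Cderive F u (p * Rcpow u (p - Cone))%cx).
  { intros u hu. eapply is_Cderive_ext_l; [|apply (is_Cderive_Rcpow (fun t => t) 1);
      [apply (is_derive_id (K := R_AbsRing))|exact hu]].
    fold Cone; ring. }
  assert (h : is_CInt01 (fun u => p * beta_fun p Cone u)%cx (F 1 - Czero)%cx).
  { destruct (is_Cderive_continuous _ _ _ (hd 1 ltac:(lra))) as [c1 c2].
    apply is_CInt01_derive with F; try assumption.
    - intros u hu. eapply is_Cderive_ext_l; [|apply hd; lra].
      unfold beta_fun. replace (Cone - Cone)%cx with Czero by ring. rewrite Rcpow_0; ring.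
    - intros u hu; apply Ccontinuous_mul;
        [apply Ccontinuous_const|apply Ccontinuous01_beta_fun; exact hu].
    - apply (filterlim_at_left_1 (fun u => Re (F u))), c1.
    - apply (filterlim_at_left_1 (fun u => Im (F u))), c2. }
  assert (h2 : is_CInt01 (fun u => p * beta_fun p Cone u)%cx (p * Beta p Cone)%cx)
    by (apply is_CInt01_scal, Beta_spec; simpl; lra).
  pose proof (is_CInt01_unique _ _ _ h2 h) as e; unfold F in e; rewrite Rcpow_1l in e.
  replace (Beta p Cone) with (Cinv p * (p * Beta p Cone))%cx by (field; exact hp0).
  rewrite e; field; exact hp0.
Qed.

(** Mean value bound on [0, u], where the derivative has norm at most [|q| / (1 - u)]. The gained
    factor [u] is what later raises the first Beta argument by one; the lost [1 / (1 - u)] lowers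
    the second by one. *)
Lemma Rcpow_sub_1_le (q : Cplx) (u : R) : 0 < Re q -> 0 < u < 1 ->
  Cnorm (Rcpow (1 - u) q - Cone)%cx <= 2 * (Cnorm q * / (1 - u) * u).
Proof.
  intros hq hu.
  rewrite <- (Rcpow_1l q). replace 1 with (1 - 0) at 2 by ring.
  replace (Cnorm q * / (1 - u) * u) with (Cnorm q * / (1 - u) * (u - 0)) by ring.
  apply (Cderive_bound (fun s => Rcpow (1 - s) q)
    (fun s => RtoC (-1) * q * Rcpow (1 - s) (q - Cone))%cx); [lra| |].
  - intros s hs. apply (is_Cderive_Rcpow (fun t => 1 - t) (-1)); [auto_derive; [exact I|ring]|lra].
  - intros s hs. rewrite !Cnorm_mul, Cnorm_RtoC, Cnorm_Rcpow.
    replace (Rabs (-1)) with 1 by (rewrite Rabs_left; lra).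
    rewrite Rmult_1_l. apply Rmult_le_compat_l; [apply Cnorm_pos|].
    eapply Rle_trans; [apply (exp_ln_le_inv (1 - s) (Re q)); lra|].
    apply Rinv_le_contravar; lra.
Qed.

Lemma Beta_real (r s : R) : 0 < r -> 0 < s ->
  is_RInt_gen (fun u => exp ((r - 1) * ln u) * exp ((s - 1) * ln (1 - u)))
    (at_right 0) (at_left 1) (Re (Beta (RtoC r) (RtoC s))).
Proof.
  intros hr hs. destruct (Beta_spec (RtoC r) (RtoC s) hr hs) as [h _].
  eapply RInt01_ext; [|exact h]. intros u hu; unfold beta_fun, Cone.
  rewrite <- !RtoC_sub, !Rcpow_RtoC, <- RtoC_mul. reflexivity.
Qed.

(** The integrands differ by [u^(p-1) (1 - u)^n ((1 - u)^q - 1)], whose norm is at most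
    [2 |q| u^(Re p) (1 - u)^(n-1)]: a real Beta integrand. The constant 4 is this 2 times the 2 of
    [is_CInt01_norm_le]. *)
Lemma Beta_sub_le (p q : Cplx) (n : nat) : 0 < Re p -> 0 < Re q -> (1 <= n)%nat ->
  Cnorm (Beta p (q + RtoC (INR n + 1)) - Beta p (RtoC (INR n + 1)))%cx
    <= 4 * Cnorm q * Re (Beta (RtoC (Re p + 1)) (RtoC (INR n))).
Proof.
  intros hp hq hn. assert (hn' : 0 < INR n) by (apply lt_0_INR; lia).
  replace (4 * Cnorm q * Re (Beta (RtoC (Re p + 1)) (RtoC (INR n))))
    with (2 * (2 * Cnorm q * Re (Beta (RtoC (Re p + 1)) (RtoC (INR n))))) by ring.
  eapply is_CInt01_norm_le.
  3: { apply (RInt01_scal (2 * Cnorm q)), Beta_real; lra. }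
  2: { replace (Beta p (q + RtoC (INR n + 1)) - Beta p (RtoC (INR n + 1)))%cx
         with (Beta p (q + RtoC (INR n + 1)) + (- Cone) * Beta p (RtoC (INR n + 1)))%cx by ring.
       apply is_CInt01_add; [|apply is_CInt01_scal]; apply Beta_spec; simpl; lra. }
  intros u hu; simpl.
  assert (e : (beta_fun p (q + RtoC (INR n + 1)) u + - Cone * beta_fun p (RtoC (INR n + 1)) u)%cx
     = (Rcpow u (p - Cone) * RtoC (exp (INR n * ln (1 - u))) * (Rcpow (1 - u) q - Cone))%cx).
  { unfold beta_fun.
    replace (q + RtoC (INR n + 1) - Cone)%cx with (q + RtoC (INR n))%cx
      by (rewrite RtoC_add; fold Cone; ring).
    replace (RtoC (INR n + 1) - Cone)%cx with (RtoC (INR n))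
      by (rewrite RtoC_add; fold Cone; ring).
    rewrite Rcpow_add, !Rcpow_RtoC. ring. }
  rewrite e, !Cnorm_mul, Cnorm_Rcpow, Cnorm_RtoC, Rabs_pos_eq by (left; apply exp_pos).
  pose proof (Rcpow_sub_1_le q u hq hu) as k.
  replace (Re (p - Cone)%cx) with (Re p - 1) by reflexivity.
  replace ((Re p + 1 - 1) * ln u) with ((Re p - 1) * ln u + ln u) by ring.
  replace ((INR n - 1) * ln (1 - u)) with (INR n * ln (1 - u) + - ln (1 - u)) by ring.
  rewrite !exp_plus, exp_Ropp, !exp_ln by lra.
  pose proof (exp_pos ((Re p - 1) * ln u)). pose proof (exp_pos (INR n * ln (1 - u))).
  set (A := exp ((Re p - 1) * ln u)) in *; set (B := exp (INR n * ln (1 - u))) in *.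
  replace (2 * Cnorm q * (A * u * (B * / (1 - u))))
    with (A * B * (2 * (Cnorm q * / (1 - u) * u))) by ring.
  apply Rmult_le_compat_l; [nra|exact k].
Qed.

(** * Euler's formula and special values of Gamma *)

Lemma Beta_nat_r (p : Cplx) (n : nat) : 0 < Re p ->
  Beta p (RtoC (INR n + 1)) =
  (RtoC (INR (fact n)) / Cprod_nat (fun k => p + RtoC (INR k)) n)%cx.
Proof.
  intros hp; induction n as [|n IH].
  - replace (RtoC (INR 0 + 1)) with Cone by (unfold Cone; f_equal; simpl; ring).
    rewrite Beta_1_r by exact hp.
    change (Cinv p = (Cone / (p + Czero))%cx).
    replace (p + Czero)%cx with p by ring. field; apply Cpos_neq0, hp.
  - rewrite RtoC_add; fold Cone.
    pose proof (lt_0_INR (S n) ltac:(lia)).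
    rewrite Beta_succ_r by (simpl Re; assumption).
    replace (Beta p (RtoC (INR (S n)))) with (Beta p (RtoC (INR n + 1)))
      by (rewrite S_INR; reflexivity).
    rewrite IH, RtoC_fact_S.
    change (Cprod_nat (fun k => p + RtoC (INR k))%cx (S n))
      with (Cprod_nat (fun k => p + RtoC (INR k))%cx n * (p + RtoC (INR (S n))))%cx.
    field; split; [apply Cpos_add_INR, hp|apply pochhammer_neq0, hp].
Qed.

Lemma Beta_add_nat_r (p q : Cplx) (n : nat) : 0 < Re p -> 0 < Re q ->
  Beta p (q + RtoC (INR n + 1))%cx =
  (Beta p q * Cprod_nat (fun k => q + RtoC (INR k)) n
    / Cprod_nat (fun k => p + q + RtoC (INR k)) n)%cx.
Proof.
  intros hp hq. assert (hpq : 0 < Re (p + q)%cx) by (simpl; lra).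
  induction n as [|n IH].
  - replace (RtoC (INR 0 + 1)) with Cone by (unfold Cone; f_equal; simpl; ring).
    rewrite Beta_succ_r by assumption.
    change (q / (p + q) * Beta p q = Beta p q * (q + Czero) / (p + q + Czero))%cx.
    replace (p + q + Czero)%cx with (p + q)%cx by ring. field; apply Cpos_neq0, hpq.
  - replace (q + RtoC (INR (S n) + 1))%cx with (q + RtoC (INR n + 1) + Cone)%cx
      by (rewrite S_INR, (RtoC_add (INR n + 1) 1); fold Cone; ring).
    rewrite Beta_succ_r by (simpl; pose proof (pos_INR n); lra).
    rewrite IH, <- S_INR.
    change (Cprod_nat (fun k => q + RtoC (INR k))%cx (S n))
      with (Cprod_nat (fun k => q + RtoC (INR k))%cx n * (q + RtoC (INR (S n))))%cx.
    change (Cprod_nat (fun k => p + q + RtoC (INR k))%cx (S n))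
      with (Cprod_nat (fun k => p + q + RtoC (INR k))%cx n * (p + q + RtoC (INR (S n))))%cx.
    field.
    split; [apply Cpos_add_INR, hpq|apply pochhammer_neq0, hpq].
Qed.

Lemma gamma_seq_Beta (p : Cplx) (n : nat) : 0 < Re p ->
  gamma_seq p n = (Rcpow (INR n) p * Beta p (RtoC (INR n + 1)))%cx.
Proof.
  intros hp; unfold gamma_seq; rewrite Beta_nat_r by exact hp.
  field; apply pochhammer_neq0, hp.
Qed.

Lemma Un_cv_div_INR (C : R) : Un_cv (fun n => C / INR n) 0.
Proof.
  apply is_lim_seq_Reals, is_lim_seq_incr_1, is_lim_seq_Reals, Un_cv_inv_INR.
Qed.

Lemma Beta_shift_cv (p q : Cplx) : 0 < Re p -> 0 < Re q ->
  Cseq_cv (fun n => Rcpow (INR n) p * Beta p (q + RtoC (INR n + 1)))%cx (CGamma p).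
Proof.
  intros hp hq.
  set (r := RtoC (Re p)).
  assert (hd : Cseq_cv (fun n => Rcpow (INR n) p *
     (Beta p (q + RtoC (INR n + 1)) - Beta p (RtoC (INR n + 1))))%cx Czero).
  (* With [r = Re p], the recurrences give [B(r+1, n) = (r / n) B(r, n+1)]. After multiplication by
     [n^r] the error is thus [O(1/n)] times a term of the convergent Gauss product at [r]. *)
  { apply Cseq_cv_squeeze with
      (v := fun n => 4 * Cnorm q * Re p / INR n * Re (gamma_seq r n)) (N := 1%nat).
    - intros n hn. assert (hn' : 0 < INR n) by (apply lt_0_INR; lia).
      replace (Rcpow (INR n) p * (Beta p (q + RtoC (INR n + 1)) - Beta p (RtoC (INR n + 1))) - Czero)%cx
        with (Rcpow (INR n) p * (Beta p (q + RtoC (INR n + 1)) - Beta p (RtoC (INR n + 1))))%cx by ring.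
      rewrite Cnorm_mul, Cnorm_Rcpow.
      pose proof (Beta_sub_le p q n hp hq hn) as k.
      apply Rle_trans with (exp (Re p * ln (INR n)) *
         (4 * Cnorm q * Re (Beta (RtoC (Re p + 1)) (RtoC (INR n)))));
        [apply Rmult_le_compat_l; [left; apply exp_pos|exact k]|].
      rewrite gamma_seq_Beta by exact hp. unfold r; rewrite Rcpow_RtoC, !RtoC_add; fold Cone.
      rewrite Beta_succ_l, Beta_succ_r by (simpl; assumption).
      rewrite <- !RtoC_add, <- !RtoC_div by lra.
      right; simpl; field; lra.
    - replace 0 with (0 * Re (CGamma r)) by ring.
      apply CV_mult; [apply Un_cv_div_INR|apply CGamma_spec, hp]. }
  replace (CGamma p) with (CGamma p + Czero)%cx by ring.
  eapply Cseq_cv_ext; [|apply Cseq_cv_add; [apply CGamma_spec, hp|exact hd]].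
  intros n; simpl. rewrite gamma_seq_Beta by exact hp. ring.
Qed.

(** For every [n], [n^p B(p, q+n+1)] times the n-th Gauss term at [q] equals [B(p, q)] times the
    n-th Gauss term at [p + q], exactly. The formula is the limit of this identity. *)
Lemma Beta_CGamma (p q : Cplx) : 0 < Re p -> 0 < Re q ->
  (CGamma p * CGamma q)%cx = (Beta p q * CGamma (p + q))%cx.
Proof.
  intros hp hq. assert (hpq : 0 < Re (p + q)%cx) by (simpl; lra).
  eapply Cseq_cv_unique.
  - apply Cseq_cv_mul; [apply (Beta_shift_cv p q hp hq)|apply CGamma_spec, hq].
  - eapply Cseq_cv_ext; [|apply Cseq_cv_mul; [apply Cseq_cv_const|apply CGamma_spec, hpq]].
    intros n; simpl. rewrite Beta_add_nat_r by assumption.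
    unfold gamma_seq; rewrite Rcpow_add.
    field; split; apply pochhammer_neq0; assumption.
Qed.

(** Euler's formula at [q = 1], where [B(z, 1) = 1 / z] and [Gamma(1) = 1]. *)
Lemma CGamma_succ (z : Cplx) : 0 < Re z -> CGamma (z + Cone)%cx = (z * CGamma z)%cx.
Proof.
  intros hz.
  pose proof (Beta_CGamma z Cone hz ltac:(simpl; lra)) as e.
  rewrite CGamma_1, Beta_1_r in e by exact hz.
  replace (CGamma z) with (CGamma z * Cone)%cx by ring.
  rewrite e; field; apply Cpos_neq0, hz.
Qed.

Lemma Cprod_nat_RtoC_pos (r : R) (n : nat) : 0 < r ->
  exists P, 0 < P /\ Cprod_nat (fun k => RtoC r + RtoC (INR k))%cx n = RtoC P.
Proof.
  intros hr; induction n as [|n [P [hP e]]].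
  - exists (r + 0); split; [lra|apply Cplx_eq; simpl; ring].
  - exists (P * (r + INR (S n))); split.
    + pose proof (pos_INR (S n)); apply Rmult_lt_0_compat; lra.
    + rewrite RtoC_mul, RtoC_add, <- e; reflexivity.
Qed.

(** A limit of nonnegative reals is real and nonnegative; [CGamma_neq0] makes it positive.
    Positivity selects the root in [CGamma_half] and makes the coefficients [bscoef] positive. *)
Lemma CGamma_RtoC (r : R) : 0 < r -> exists g, 0 < g /\ CGamma (RtoC r) = RtoC g.
Proof.
  intros hr.
  assert (h : forall n, 0 <= Re (gamma_seq (RtoC r) n) /\ Im (gamma_seq (RtoC r) n) = 0).
  { intros n; destruct (Cprod_nat_RtoC_pos r n hr) as [P [hP e]].
    unfold gamma_seq; rewrite e, Rcpow_RtoC, <- RtoC_mul, <- RtoC_div by lra.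
    simpl; split; [|reflexivity].
    apply Rdiv_le_0_compat; [|exact hP].
    apply Rmult_le_pos; [apply pos_INR|left; apply exp_pos]. }
  destruct (CGamma_spec (RtoC r) hr) as [c1 c2].
  pose proof (CGamma_neq0 (RtoC r) hr) as ne.
  assert (hi : Im (CGamma (RtoC r)) = 0).
  { eapply UL_sequence; [exact c2|]. intros eps he; exists O; intros n _.
    rewrite (proj2 (h n)); unfold Rdist; rewrite Rminus_0_r, Rabs_R0; exact he. }
  assert (hre : Rbar_le 0 (Re (CGamma (RtoC r)))).
  { apply (is_lim_seq_le (fun _ => 0) (fun n => Re (gamma_seq (RtoC r) n)));
      [intros n; apply h|apply is_lim_seq_const|apply is_lim_seq_Reals, c1]. }
  simpl in hre.
  exists (Re (CGamma (RtoC r))); split; [|apply Cplx_eq; [reflexivity|exact hi]].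
  destruct hre as [hre|hre]; [exact hre|].
  exfalso; apply ne, Cplx_eq; simpl; [symmetry; exact hre|exact hi].
Qed.

Lemma exp_neg_half_ln (x : R) : 0 < x -> exp ((1 / 2 - 1) * ln x) = / sqrt x.
Proof.
  intros hx. rewrite <- Rpower_sqrt, <- Rpower_Ropp by exact hx.
  unfold Rpower; f_equal; field.
Qed.

(* With [u = sin^2 t], [sqrt u / (1 + sqrt (1 - u)) = tan (t / 2)]. *)
Lemma Beta_half_half : Re (Beta (RtoC (1 / 2)) (RtoC (1 / 2))) = PI.
Proof.
  set (A := fun u => 4 * atan (sqrt u / (1 + sqrt (1 - u)))).
  eapply RInt01_unique; [apply Beta_real; lra|].
  (* This primitive stays continuous on the closed interval, so its limits at the ends are the
     values [A 0 = 0] and [A 1 = 4 * (PI / 4)]. *)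
  assert (hc : forall u, 0 <= u <= 1 -> continuous A u).
  { intros u hu; unfold A.
    assert (0 <= sqrt (1 - u)) by apply sqrt_pos.
    apply (continuous_mult (K := R_AbsRing) (fun _ => 4)); [apply continuous_const|].
    apply (continuous_comp (fun u => sqrt u / (1 + sqrt (1 - u))) atan).
    - apply (continuous_mult (K := R_AbsRing) sqrt (fun u => / (1 + sqrt (1 - u))));
        [apply continuous_sqrt|].
      apply (continuous_comp (fun u => 1 + sqrt (1 - u)) Rinv).
      + apply (continuous_plus (fun _ => 1) (fun u => sqrt (1 - u))); [apply continuous_const|].
        apply (continuous_comp (fun u => 1 - u) sqrt); [|apply continuous_sqrt].
        apply is_derive_continuous with (-1); auto_derive; [exact I|ring].
      + apply continuous_Rinv; lra.
    - eapply is_derive_continuous, is_derive_atan. }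
  replace PI with (A 1 - A 0).
  2: { unfold A. rewrite sqrt_0, Rminus_diag, sqrt_0, sqrt_1, Rdiv_0_l, atan_0.
       replace (1 / (1 + 0)) with 1 by field. rewrite atan_1; field. }
  assert (hs : forall u, 0 < u < 1 ->
    exp ((1 / 2 - 1) * ln u) * exp ((1 / 2 - 1) * ln (1 - u)) = / (sqrt u * sqrt (1 - u))).
  { intros u hu; rewrite !exp_neg_half_ln by lra. rewrite Rinv_mult; reflexivity. }
  apply (RInt01_derive A).
  - intros u hu; rewrite hs by exact hu; unfold A.
    assert (p1 : 0 < sqrt u) by (apply sqrt_lt_R0; lra).
    assert (p2 : 0 < sqrt (1 - u)) by (apply sqrt_lt_R0; lra).
    assert (e1 : sqrt u * sqrt u = u) by (apply sqrt_sqrt; lra).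
    assert (e2 : sqrt (1 - u) * sqrt (1 - u) = 1 - u) by (apply sqrt_sqrt; lra).
    auto_derive; [replace (1 + - u) with (1 - u) by ring; repeat split; lra|].
    replace (1 + - u) with (1 - u) by ring.
    set (s := sqrt u) in *; set (c := sqrt (1 - u)) in *.
    assert (e3 : s * s = 1 - c * c) by lra.
    (* Here [?x] is the derivative of [sqrt u / (1 + sqrt (1 - u))] and [?y] is one plus the square
       of that quotient, which reduces to [2 / (1 + c)] because [s * s = 1 - c * c]. *)
    match goal with |- 4 * (?x * / ?y) = _ =>
      assert (k1 : x = (c * (1 + c) + s * s) / (2 * s * c * ((1 + c) * (1 + c)))) by (field; lra);
      assert (k2 : y = 1 + s * s / ((1 + c) * (1 + c))) by (field; lra)
    end.
    rewrite k1, k2, e3.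
    replace (1 + (1 - c * c) / ((1 + c) * (1 + c))) with (2 / (1 + c)) by (field; lra).
    field; lra.
  - intros u hu. apply continuous_ext_loc with (fun u => / (sqrt u * sqrt (1 - u))).
    + exists (mkposreal (Rmin u (1 - u)) ltac:(apply Rmin_pos; lra)); intros y hy.
      apply Rabs_lt_between' in hy; simpl in hy.
      pose proof (Rmin_l u (1 - u)); pose proof (Rmin_r u (1 - u)).
      symmetry; apply hs; lra.
    + assert (p1 : 0 < sqrt u) by (apply sqrt_lt_R0; lra).
      assert (p2 : 0 < sqrt (1 - u)) by (apply sqrt_lt_R0; lra).
      eapply is_derive_continuous; auto_derive; [|reflexivity].
      replace (1 + - u) with (1 - u) by ring; repeat split; try lra. apply Rgt_not_eq; nra.
  - apply (filterlim_at_right_0 A), hc; lra.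
  - apply (filterlim_at_left_1 A), hc; lra.
Qed.

Lemma CGamma_half : CGamma (RtoC (1 / 2)) = RtoC (sqrt PI).
Proof.
  destruct (CGamma_RtoC (1 / 2)) as [g [hg e]]; [lra|].
  pose proof (Beta_CGamma (RtoC (1 / 2)) (RtoC (1 / 2)) ltac:(simpl; lra) ltac:(simpl; lra)) as h.
  rewrite <- RtoC_add in h. replace (1 / 2 + 1 / 2) with 1 in h by field.
  fold Cone in h. rewrite CGamma_1, e in h. apply (f_equal Re) in h.
  simpl in h; rewrite Beta_half_half in h.
  rewrite e; f_equal. replace PI with (g * g) by lra.
  symmetry; apply sqrt_square; lra.
Qed.

(** Passing from [k] to [k + 1] exchanges the roles of the two factors: the second becomes the
    first, and the first, with argument raised by 1, becomes the second. Each step thus costs one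
    functional equation with factor [(k + 1) / 2], starting from [Gamma(1/2) = sqrt PI]. *)
Lemma CGamma_duplication_nat (k : nat) :
  (CGamma (RtoC (1 / 2) + RtoC (1 / 2 * INR k)) * CGamma (Cone + RtoC (1 / 2 * INR k)))%cx
  = (RtoC (sqrt PI) * RtoC (INR (fact k)) * Cpow (RtoC (1 / 2)) k)%cx.
Proof.
  induction k as [|k IH].
  - simpl INR; rewrite Rmult_0_r; fold Czero.
    replace (RtoC (1 / 2) + Czero)%cx with (RtoC (1 / 2)) by ring.
    replace (Cone + Czero)%cx with Cone by ring.
    rewrite CGamma_half, CGamma_1; simpl; fold Cone; ring.
  - pose proof (pos_INR k).
    replace (RtoC (1 / 2) + RtoC (1 / 2 * INR (S k)))%cx with (Cone + RtoC (1 / 2 * INR k))%cx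
      by (unfold Cone; rewrite <- !RtoC_add, S_INR; f_equal; field).
    replace (Cone + RtoC (1 / 2 * INR (S k)))%cx
      with (RtoC (1 / 2) + RtoC (1 / 2 * INR k) + Cone)%cx
      by (unfold Cone; rewrite <- !RtoC_add, S_INR; f_equal; field).
    rewrite CGamma_succ by (simpl; lra).
    replace (CGamma (Cone + RtoC (1 / 2 * INR k)) *
      ((RtoC (1 / 2) + RtoC (1 / 2 * INR k)) * CGamma (RtoC (1 / 2) + RtoC (1 / 2 * INR k))))%cx
      with ((RtoC (1 / 2) + RtoC (1 / 2 * INR k)) *
       (CGamma (RtoC (1 / 2) + RtoC (1 / 2 * INR k)) * CGamma (Cone + RtoC (1 / 2 * INR k))))%cx by ring.
    rewrite IH, RtoC_fact_S.
    replace (RtoC (1 / 2) + RtoC (1 / 2 * INR k))%cx with (RtoC (1 / 2) * RtoC (INR (S k)))%cx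
      by (rewrite <- RtoC_mul, <- RtoC_add, S_INR; f_equal; ring).
    simpl Cpow; ring.
Qed.

(** * The power series of I_0 + L_0 *)

Lemma Csum_nat_norm_le (t : nat -> Cplx) (A : nat -> R) (n : nat) :
  (forall k, Cnorm (t k) <= A k) -> Cnorm (Csum_nat t n) <= sum_f_R0 A n.
Proof.
  intros h; induction n; simpl; [apply h|].
  eapply Rle_trans; [apply Cnorm_add|]. apply Rplus_le_compat; [exact IHn|apply h].
Qed.

Lemma Csum_nat_mul_l (c : Cplx) (t : nat -> Cplx) (n : nat) :
  Csum_nat (fun k => c * t k)%cx n = (c * Csum_nat t n)%cx.
Proof. induction n; simpl; [reflexivity|rewrite IHn; ring]. Qed.

Lemma Csum_nat_sub (s t : nat -> Cplx) (n : nat) :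
  Csum_nat (fun k => s k - t k)%cx n = (Csum_nat s n - Csum_nat t n)%cx.
Proof. induction n; simpl; [reflexivity|rewrite IHn; ring]. Qed.

Lemma Csum_nat_ext (s t : nat -> Cplx) (n : nat) :
  (forall k, s k = t k) -> Csum_nat s n = Csum_nat t n.
Proof. intros h; induction n; simpl; [apply h|rewrite IHn, h; reflexivity]. Qed.

Lemma Csum_nat_even_odd (t : nat -> Cplx) (n : nat) :
  (Csum_nat (fun k => t (2 * k)%nat) n + Csum_nat (fun k => t (2 * k + 1)%nat) n)%cx
  = Csum_nat t (2 * n + 1).
Proof.
  induction n; [reflexivity|].
  replace (2 * S n + 1)%nat with (S (S (2 * n + 1))) by lia.
  cbn [Csum_nat]. rewrite <- IHn.
  replace (S (2 * n + 1)) with (2 * S n)%nat by lia.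
  replace (S (2 * S n)) with (2 * S n + 1)%nat by lia. ring.
Qed.

Lemma Cseries_sum_eq (t : nat -> Cplx) (s : Cplx) : Cseries_cv t s -> Cseries_sum t = s.
Proof.
  intros h; eapply Cseq_cv_unique; [|exact h].
  unfold Cseries_sum; apply (epsilon_spec C_inhabited (Cseries_cv t)). exists s; exact h.
Qed.

(** Besides convergence this yields a remainder bound that depends only on the majorant, from which
    uniform convergence follows. *)
Lemma Cseries_dominated (t : nat -> Cplx) (A : nat -> R) (L : R) :
  (forall k, Cnorm (t k) <= A k) -> Un_cv (sum_f_R0 A) L ->
  Cseries_cv t (Cseries_sum t) /\
  forall n, Cnorm (Cseries_sum t - Csum_nat t n)%cx <= L - sum_f_R0 A n.
Proof.
  intros h hA.
  assert (hd : forall n m, (n <= m)%nat ->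
    Cnorm (Csum_nat t m - Csum_nat t n)%cx <= sum_f_R0 A m - sum_f_R0 A n).
  { intros n m hm; induction hm as [|m hm IH].
    - replace (Csum_nat t n - Csum_nat t n)%cx with Czero by ring.
      unfold Czero; rewrite Cnorm_RtoC, Rabs_R0; lra.
    - simpl. replace (Csum_nat t m + t (S m) - Csum_nat t n)%cx
        with ((Csum_nat t m - Csum_nat t n) + t (S m))%cx by ring.
      eapply Rle_trans; [apply Cnorm_add|]. specialize (h (S m)); lra. }
  assert (A0 : forall k, 0 <= A k)
    by (intros k; eapply Rle_trans; [apply Cnorm_pos|apply h]).
  assert (hL : forall n, sum_f_R0 A n <= L).
  { intros n; apply (growing_ineq (sum_f_R0 A)); [|exact hA].
    intros k; simpl; specialize (A0 (S k)); lra. }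
  destruct (Cseq_cv_Cauchy (Csum_nat t)) as [s hs].
  { intros eps he; destruct (hA eps he) as [N hN]; exists N; intros m n hn hm.
    eapply Rle_lt_trans; [apply hd, hm|]. specialize (hN n hn); unfold Rdist in hN.
    apply Rabs_def2 in hN; specialize (hL m); lra. }
  rewrite (Cseries_sum_eq t s hs); split; [exact hs|].
  intros n. apply Cseq_cv_norm_le with (u := fun m => (Csum_nat t m - Csum_nat t n)%cx) (N := n).
  - intros m hm; eapply Rle_trans; [apply hd, hm|]. specialize (hL m); lra.
  - apply (Cseq_cv_add _ (fun _ => (- Csum_nat t n)%cx)); [exact hs|apply Cseq_cv_const].
Qed.

(** Multiples of exponential series serve as majorants for all the series below. *)
Lemma exp_series_cv (C x : R) :
  Un_cv (sum_f_R0 (fun k => C * (/ INR (fact k) * x ^ k))) (C * exp x).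
Proof.
  assert (h : Un_cv (sum_f_R0 (fun k => / INR (fact k) * x ^ k)) (exp x)).
  { unfold exp; destruct (exist_exp x) as [l hl]; exact hl. }
  apply is_lim_seq_Reals.
  apply is_lim_seq_ext with (fun n => C * sum_f_R0 (fun k => / INR (fact k) * x ^ k) n).
  - intros n; rewrite scal_sum; apply sum_eq; intros; ring.
  - apply (is_lim_seq_scal_l _ C (exp x)), is_lim_seq_Reals, h.
Qed.

(* The common coefficient [(1/2)^k / Gamma(k/2 + 1)^2] of [z^k] in [I_0] (even [k])
   and [L_0] (odd [k]). *)
Definition bscoef (k : nat) : R := (1 / 2) ^ k / Re (CGamma (Cone + RtoC (1 / 2 * INR k))%cx) ^ 2.

Lemma CGamma_half_int (k : nat) :
  exists g, 0 < g /\ CGamma (Cone + RtoC (1 / 2 * INR k))%cx = RtoC g.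
Proof.
  replace (Cone + RtoC (1 / 2 * INR k))%cx with (RtoC (1 + 1 / 2 * INR k))
    by (rewrite RtoC_add; reflexivity).
  pose proof (pos_INR k). apply CGamma_RtoC; lra.
Qed.

Lemma bscoef_pos (k : nat) : 0 < bscoef k.
Proof.
  unfold bscoef. destruct (CGamma_half_int k) as [g [h e]]; rewrite e.
  apply Rdiv_lt_0_compat; apply pow_lt; [lra|exact h].
Qed.

Lemma RtoC_bscoef (k : nat) : RtoC (bscoef k) =
  (Cpow (RtoC (1 / 2)) k /
     (CGamma (Cone + RtoC (1 / 2 * INR k)) * CGamma (Cone + RtoC (1 / 2 * INR k))))%cx.
Proof.
  unfold bscoef. destruct (CGamma_half_int k) as [g [h e]]; rewrite e; simpl Re.
  rewrite <- RtoC_mul, <- RtoC_pow, <- RtoC_div by (apply Rgt_not_eq; nra).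
  f_equal; f_equal; ring.
Qed.

(** Two steps in [k] raise the Gamma argument by 1, giving the factor [(k/2 + 1)^2]; together with
    [(1/2)^2] this makes [(k + 2)^2]. *)
Lemma bscoef_rec (k : nat) : bscoef (S (S k)) = bscoef k / (INR k + 2) ^ 2.
Proof.
  unfold bscoef. destruct (CGamma_half_int k) as [g [h e]]. pose proof (pos_INR k).
  replace (Cone + RtoC (1 / 2 * INR (S (S k))))%cx with (Cone + RtoC (1 / 2 * INR k) + Cone)%cx
    by (unfold Cone; rewrite <- !RtoC_add, !S_INR; f_equal; field).
  rewrite CGamma_succ by (simpl; lra). rewrite e.
  replace (Cone + RtoC (1 / 2 * INR k))%cx with (RtoC (1 + 1 / 2 * INR k))
    by (rewrite RtoC_add; reflexivity).
  rewrite <- RtoC_mul. simpl Re. simpl pow. field. lra.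
Qed.

Definition bsbound : R := bscoef 0 + bscoef 1.

(** Two steps divide the coefficient by [(k + 2)^2], which exceeds the growth [(k + 2) (k + 1)] of
    the factorial. The induction therefore carries two consecutive indices, and [bsbound] covers
    both starting values. *)
Lemma bscoef_le (k : nat) : bscoef k <= bsbound * / INR (fact k).
Proof.
  assert (h : forall k, bscoef k <= bsbound * / INR (fact k) /\
                        bscoef (S k) <= bsbound * / INR (fact (S k))).
  { pose proof (bscoef_pos 0); pose proof (bscoef_pos 1). unfold bsbound.
    clear k; induction k as [|k [IH1 IH2]]; [simpl; lra|].
    split; [exact IH2|]. rewrite bscoef_rec.
    rewrite (fact_simpl (S k)), (fact_simpl k), !mult_INR, !S_INR.
    pose proof (INR_fact_lt_0 k). pose proof (pos_INR k).
    replace ((bscoef 0 + bscoef 1) * / ((INR k + 1 + 1) * ((INR k + 1) * INR (fact k))))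
      with (((bscoef 0 + bscoef 1) * / INR (fact k)) * / ((INR k + 2) * (INR k + 1)))
      by (field; lra).
    unfold Rdiv; apply Rmult_le_compat.
    - left; apply bscoef_pos.
    - left; apply Rinv_0_lt_compat; nra.
    - exact IH1.
    - apply Rinv_le_contravar; nra. }
  apply h.
Qed.

Definition bsterm (z : Cplx) (k : nat) : Cplx := (RtoC (bscoef k) * Cpow z k)%cx.

Lemma bsbound_pos : 0 < bsbound.
Proof. pose proof (bscoef_pos 0); pose proof (bscoef_pos 1); unfold bsbound; lra. Qed.

Lemma bsterm_norm_le (z : Cplx) (r : R) (k : nat) : Cnorm z <= r ->
  Cnorm (bsterm z k) <= bsbound * (/ INR (fact k) * r ^ k).
Proof.
  intros hz; unfold bsterm.
  rewrite Cnorm_mul, Cnorm_RtoC, Cnorm_pow, Rabs_pos_eq by (left; apply bscoef_pos).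
  rewrite <- Rmult_assoc. apply Rmult_le_compat.
  - left; apply bscoef_pos.
  - apply pow_le, Cnorm_pos.
  - apply bscoef_le.
  - apply pow_incr; split; [apply Cnorm_pos|exact hz].
Qed.

Definition bs (z : Cplx) : Cplx := Cseries_sum (bsterm z).

(** The remainder is bounded by that of an exponential series at [r], hence uniformly on the disc of
    radius [r]. *)
Lemma bs_spec (z : Cplx) (r : R) : Cnorm z <= r ->
  Cseries_cv (bsterm z) (bs z) /\
  forall n, Cnorm (bs z - Csum_nat (bsterm z) n)%cx
    <= bsbound * exp r - sum_f_R0 (fun k => bsbound * (/ INR (fact k) * r ^ k)) n.
Proof.
  intros hz; apply Cseries_dominated.
  - intros k; apply bsterm_norm_le, hz.
  - apply exp_series_cv.
Qed.

Lemma CGamma_fact (n : nat) : CGamma (Cone + RtoC (INR n))%cx = RtoC (INR (fact n)).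
Proof.
  induction n as [|n IH].
  - replace (Cone + RtoC (INR 0))%cx with Cone by (apply Cplx_eq; simpl; ring).
    exact CGamma_1.
  - replace (Cone + RtoC (INR (S n)))%cx with (Cone + RtoC (INR n) + Cone)%cx
      by (rewrite S_INR, RtoC_add; fold Cone; ring).
    pose proof (pos_INR n).
    rewrite CGamma_succ, IH, RtoC_fact_S, S_INR, RtoC_add by (simpl; lra). fold Cone. ring.
Qed.

(** [(2k)! >= k!]. The even terms need a majorant of their own with a known sum, here the series of
    [exp (r * r)]; the odd terms are treated alike. *)
Lemma even_exp_majorant (r : R) (k : nat) : 0 <= r ->
  / INR (fact (2 * k)) * r ^ (2 * k) <= / INR (fact k) * (r * r) ^ k.
Proof.
  intros hr. rewrite pow_mult. replace (r ^ 2) with (r * r) by ring.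
  apply Rmult_le_compat_r; [apply pow_le; nra|].
  apply Rinv_le_contravar; [apply INR_fact_lt_0|apply le_INR, fact_le; lia].
Qed.

Lemma odd_exp_majorant (r : R) (k : nat) : 0 <= r ->
  / INR (fact (2 * k + 1)) * r ^ (2 * k + 1) <= r * (/ INR (fact k) * (r * r) ^ k).
Proof.
  intros hr. rewrite pow_add, pow_mult, pow_1. replace (r ^ 2) with (r * r) by ring.
  replace (r * (/ INR (fact k) * (r * r) ^ k)) with (/ INR (fact k) * ((r * r) ^ k * r)) by ring.
  apply Rmult_le_compat_r; [apply Rmult_le_pos; [apply pow_le; nra|exact hr]|].
  apply Rinv_le_contravar; [apply INR_fact_lt_0|apply le_INR, fact_le; lia].
Qed.

Lemma Cpow_half_div (z : Cplx) (n : nat) :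
  Cpow (z / RtoC 2)%cx n = (Cpow (RtoC (1 / 2)) n * Cpow z n)%cx.
Proof.
  rewrite <- Cpow_mul; f_equal. rewrite RtoC_div by lra. fold Cone.
  field. apply RtoC_neq0; lra.
Qed.

Lemma bsterm_even (z : Cplx) (k : nat) : bsterm z (2 * k) =
  (Cpow (z / RtoC 2)%cx (2 * k) / RtoC (INR (fact k) * INR (fact k)))%cx.
Proof.
  unfold bsterm; rewrite RtoC_bscoef, Cpow_half_div.
  replace (1 / 2 * INR (2 * k)) with (INR k) by (rewrite mult_INR; simpl; field).
  rewrite CGamma_fact, RtoC_mul. field; apply RtoC_fact_neq0.
Qed.

Lemma bsterm_odd (z : Cplx) (k : nat) : bsterm z (2 * k + 1) =
  (Cpow (z / RtoC 2)%cx (2 * k + 1) /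
     (CGamma (RtoC (INR k + 3 / 2)) * CGamma (RtoC (INR k + 3 / 2))))%cx.
Proof.
  unfold bsterm; rewrite RtoC_bscoef, Cpow_half_div.
  replace (Cone + RtoC (1 / 2 * INR (2 * k + 1)))%cx with (RtoC (INR k + 3 / 2))
    by (unfold Cone; rewrite <- RtoC_add, plus_INR, mult_INR; f_equal; simpl; field).
  pose proof (pos_INR k).
  field. apply CGamma_neq0; simpl; lra.
Qed.

(** Even-indexed terms form [I_0], odd-indexed ones [L_0]. Both subseries converge by domination,
    and the sum of their n-th partial sums is the partial sum of [bs] of index [2 n + 1]. *)
Lemma bessel_add_struve (z : Cplx) : (besselI0 z + struveL0 z)%cx = bs z.
Proof.
  set (r := Cnorm z).
  assert (hr : 0 <= r) by apply Cnorm_pos.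
  destruct (Cseries_dominated (fun k => bsterm z (2 * k))
    (fun k => bsbound * (/ INR (fact k) * (r * r) ^ k)) (bsbound * exp (r * r))) as [h1 _].
  { intros k; eapply Rle_trans; [apply (bsterm_norm_le z r), Rle_refl|].
    apply Rmult_le_compat_l; [left; apply bsbound_pos|apply even_exp_majorant, hr]. }
  { apply exp_series_cv. }
  destruct (Cseries_dominated (fun k => bsterm z (2 * k + 1))
    (fun k => bsbound * r * (/ INR (fact k) * (r * r) ^ k)) (bsbound * r * exp (r * r))) as [h2 _].
  { intros k; eapply Rle_trans; [apply (bsterm_norm_le z r), Rle_refl|].
    rewrite Rmult_assoc.
    apply Rmult_le_compat_l; [left; apply bsbound_pos|apply odd_exp_majorant, hr]. }
  { apply exp_series_cv. }
  replace (besselI0 z) with (Cseries_sum (fun k => bsterm z (2 * k)))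
    by (unfold besselI0; f_equal; apply functional_extensionality; intros k; apply bsterm_even).
  replace (struveL0 z) with (Cseries_sum (fun k => bsterm z (2 * k + 1)))
    by (unfold struveL0; f_equal; apply functional_extensionality; intros k; apply bsterm_odd).
  destruct (bs_spec z r (Rle_refl _)) as [h3 _].
  eapply Cseq_cv_unique; [apply Cseq_cv_add; [exact h1|exact h2]|].
  eapply Cseq_cv_ext; [intros n; symmetry; apply (Csum_nat_even_odd (bsterm z))|].
  apply Cseq_cv_norm; intros eps he.
  destruct (proj1 (Cseq_cv_norm _ _) h3 eps he) as [N hN].
  exists N; intros n hn; apply hN; lia.
Qed.

Lemma Ccontinuous_Csum_nat (f : nat -> R -> Cplx) (n : nat) (u : R) :
  (forall k, Ccontinuous (f k) u) -> Ccontinuous (fun x => Csum_nat (fun k => f k x) n) u.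
Proof.
  intros h; induction n; simpl; [apply h|].
  apply Ccontinuous_add; [exact IHn|apply h].
Qed.

Lemma Ccontinuous_bsterm (w : Cplx) (k : nat) (u : R) :
  Ccontinuous (fun x => bsterm (w * RtoC x)%cx k) u.
Proof.
  unfold bsterm; apply Ccontinuous_mul; [apply Ccontinuous_const|].
  induction k; simpl; [apply Ccontinuous_const|].
  apply Ccontinuous_mul; [|exact IHk].
  apply Ccontinuous_mul; [apply Ccontinuous_const|apply Ccontinuous_RtoC, continuous_id].
Qed.

Lemma Cnorm_mul_RtoC_le (w : Cplx) (u : R) : Rabs u <= 1 -> Cnorm (w * RtoC u)%cx <= Cnorm w.
Proof.
  intros hu; rewrite Cnorm_mul, Cnorm_RtoC.
  pose proof (Cnorm_pos w). rewrite <- (Rmult_1_r (Cnorm w)) at 2.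
  apply Rmult_le_compat_l; assumption.
Qed.

(** The partial sums are continuous and converge uniformly for [|u| < 1], since [|w u| <= |w|] makes
    the remainder bound independent of [u]. *)
Lemma Ccontinuous01_bs (w : Cplx) : Ccontinuous01 (fun u => bs (w * RtoC u)%cx).
Proof.
  intros u hu.
  assert (hcv := exp_series_cv bsbound (Cnorm w)).
  assert (key : forall pr : Cplx -> R, (forall z v, pr (z - v)%cx = pr z - pr v) ->
    (forall z, Rabs (pr z) <= Cnorm z) ->
    (forall f x, Ccontinuous f x -> continuous (fun t => pr (f t)) x) ->
    continuous (fun t => pr (bs (w * RtoC t)%cx)) u).
  { intros pr hs hp hc. apply continuity_pt_filterlim.
    apply (CVU_continuity (fun n x => pr (Csum_nat (bsterm (w * RtoC x)%cx) n))
      (fun t => pr (bs (w * RtoC t)%cx)) 0 (mkposreal 1 Rlt_0_1)).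
    - intros eps he; destruct (hcv eps he) as [N hN]; exists N; intros n x hn hx.
      unfold Boule in hx; simpl in hx; rewrite Rminus_0_r in hx.
      rewrite <- hs. eapply Rle_lt_trans; [apply hp|].
      eapply Rle_lt_trans;
        [apply (bs_spec (w * RtoC x)%cx (Cnorm w)), Cnorm_mul_RtoC_le; lra|].
      specialize (hN n hn); unfold Rdist in hN; apply Rabs_def2 in hN; lra.
    - intros n y _; apply continuity_pt_filterlim.
      apply (hc (fun x => Csum_nat (bsterm (w * RtoC x)%cx) n)).
      apply (Ccontinuous_Csum_nat (fun k x => bsterm (w * RtoC x)%cx k)).
      intros k; apply Ccontinuous_bsterm.
    - unfold Boule; simpl; rewrite Rminus_0_r; apply Rabs_def1; lra. }
  split; [apply (key Re)|apply (key Im)]; try reflexivity;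
    [apply Cnorm_Re|intros f x h; apply h|apply Cnorm_Im|intros f x h; apply h].
Qed.

(** * Termwise integration *)

Lemma CInt_Csum_nat (f : nat -> R -> Cplx) (n : nat) (a b : R) :
  (forall k, Ccontinuous01 (f k)) -> 0 < a < 1 -> 0 < b < 1 ->
  CInt (fun u => Csum_nat (fun k => f k u) n) a b = Csum_nat (fun k => CInt (f k) a b) n.
Proof.
  intros h ha hb; induction n as [|n IH]; [reflexivity|].
  simpl; rewrite <- IH. apply (CInt_add (fun u => Csum_nat (fun k => f k u) n)); try assumption.
  - intros u hu; apply (Ccontinuous_Csum_nat f); intros k; apply h, hu.
  - apply h.
Qed.

Lemma Cpow_RtoC_mul (w : Cplx) (u : R) (k : nat) :
  Cpow (w * RtoC u)%cx k = (Cpow w k * RtoC (u ^ k))%cx.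
Proof. rewrite Cpow_mul, RtoC_pow; reflexivity. Qed.

(** The integrand left after the substitution, for [p = lam - mu] and [q = 2 mu], apart from the
    series. The factor [1 + u] is a remnant of the Jacobian, since
    [dx = - (a/2) (1 - u) (1 + u) / u^2 du]. *)
Definition kernel (p q : Cplx) (u : R) : Cplx := (beta_fun p q u * (Cone + RtoC u))%cx.

Lemma Ccontinuous01_kernel (p q : Cplx) : Ccontinuous01 (kernel p q).
Proof.
  intros u hu; apply Ccontinuous_mul; [apply Ccontinuous01_beta_fun, hu|].
  apply Ccontinuous_add; [apply Ccontinuous_const|apply Ccontinuous_RtoC, continuous_id].
Qed.

Lemma is_CInt01_kernel (p q : Cplx) : 0 < Re p -> 0 < Re q ->
  is_CInt01 (kernel p q) (Beta p q + Beta (p + Cone) q)%cx.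
Proof.
  intros hp hq.
  eapply is_CInt01_ext; [|apply is_CInt01_add; apply Beta_spec; simpl; lra].
  intros u hu; unfold kernel, beta_fun.
  replace (p + Cone - Cone)%cx with (p - Cone + Cone)%cx by ring.
  rewrite Rcpow_add, Rcpow_1 by lra. ring.
Qed.

Lemma kernel_add_nat (p q : Cplx) (k : nat) (u : R) : 0 < u ->
  kernel (p + RtoC (INR k))%cx q u = (RtoC (u ^ k) * kernel p q u)%cx.
Proof.
  intros hu; unfold kernel, beta_fun.
  replace (p + RtoC (INR k) - Cone)%cx with (p - Cone + RtoC (INR k))%cx by ring.
  rewrite Rcpow_add, Rcpow_nat by exact hu. ring.
Qed.

Lemma Cnorm_kernel_le (p q : Cplx) (u : R) : 0 < Re p -> 0 < Re q -> 0 < u < 1 ->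
  Cnorm (kernel p q u) <= 2 * beta_majorant (Re p) (Re q) u.
Proof.
  intros hp hq hu; unfold kernel.
  rewrite Cnorm_mul, Rmult_comm. unfold Cone; rewrite <- RtoC_add, Cnorm_RtoC, Rabs_pos_eq by lra.
  apply Rmult_le_compat; [lra|apply Cnorm_pos|lra|apply Cnorm_beta_fun_le; assumption].
Qed.

Lemma Ccontinuous01_kernel_bs (p q w : Cplx) :
  Ccontinuous01 (fun u => kernel p q u * bs (w * RtoC u))%cx.
Proof.
  intros u hu; apply Ccontinuous_mul; [apply Ccontinuous01_kernel, hu|apply Ccontinuous01_bs, hu].
Qed.

(** By [is_CInt01_kernel] and [kernel_add_nat], this is the integral of [u^k] against the kernel. *)
Definition kernel_moment (p q : Cplx) (k : nat) : Cplx :=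
  (Beta (p + RtoC (INR k)) q + Beta (p + RtoC (INR k) + Cone) q)%cx.

(** On a fixed inner interval termwise integration follows from the uniform remainder bound for
    [bs]. Each integrated term differs from its full moment by at most a quantity independent of
    [k], so the total error is that quantity times the sum of the norms of the coefficients. *)
Lemma CInt_kernel_bs (p q w : Cplx) : 0 < Re p -> 0 < Re q ->
  exists T, Cseries_cv (fun k => bsterm w k * kernel_moment p q k)%cx T /\
  forall a b, 0 < a < 1 -> 0 < b < 1 ->
    Cnorm (CInt (fun u => kernel p q u * bs (w * RtoC u))%cx a b - T)%cx <=
    bsbound * exp (Cnorm w) * (4 * (Rabs (beta_primitive (Re p) (Re q) a - - (2 / Re q)) +
                                    Rabs (beta_primitive (Re p) (Re q) b - 2 / Re p))).
Proof.
  intros hp hq.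
  set (H0 := beta_primitive (Re p) (Re q)). set (h0 := beta_majorant (Re p) (Re q)).
  set (l0 := - (2 / Re q)). set (l1 := 2 / Re p).
  (* The constant 4 combines [1 + u <= 2] with the factor 2 lost on real and imaginary parts. *)
  set (tail := fun a b => 4 * (Rabs (H0 a - l0) + Rabs (H0 b - l1))).
  set (f := fun k => kernel (p + RtoC (INR k))%cx q).
  assert (dH : forall c u, 0 < u < 1 -> is_derive (fun u => c * H0 u) u (c * h0 u)).
  { intros c u hu; apply (is_derive_scal H0), is_derive_beta_primitive; assumption. }
  assert (ch : forall c u, 0 < u < 1 -> continuous (fun u => c * h0 u) u).
  { intros c u hu; apply (continuous_mult (K := R_AbsRing) (fun _ => c));
    [apply continuous_const|apply continuous_beta_majorant, hu]. }
  assert (hf : forall k u, 0 < u < 1 -> Cnorm (f k u) <= 2 * h0 u).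
  { intros k u hu; unfold f; rewrite kernel_add_nat, Cnorm_mul, Cnorm_RtoC by lra.
    pose proof (Cnorm_kernel_le p q u hp hq hu).
    assert (0 <= u ^ k <= 1).
    { split; [apply pow_le; lra|]. rewrite <- (pow1 k). apply pow_incr; lra. }
    rewrite Rabs_pos_eq by lra. pose proof (Cnorm_pos (kernel p q u)).
    unfold h0; nra. }
  assert (pk : forall k, 0 < Re (p + RtoC (INR k))%cx)
    by (intros k; simpl; pose proof (pos_INR k); lra).
  assert (htail : forall k a b, 0 < a < 1 -> 0 < b < 1 ->
    Cnorm (CInt (f k) a b - kernel_moment p q k)%cx <= tail a b).
  { intros k.
    (* The summand [0 * l0] gives the limit of [2 * H0] the two-term shape of [filterlim_lin]. *)
    destruct (is_CInt01_dominated (fun u => 2 * H0 u) (fun u => 2 * h0 u) (2 * l0 + 0 * l0)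
      (2 * l1 + 0 * l1) (f k)) as [v [hv hb]].
    - apply dH.
    - apply ch.
    - apply filterlim_ext with (fun u => 2 * H0 u + 0 * H0 u); [intros u; ring|].
      apply (filterlim_lin (at_right 0)); apply beta_primitive_at_0, hp.
    - apply filterlim_ext with (fun u => 2 * H0 u + 0 * H0 u); [intros u; ring|].
      apply (filterlim_lin (at_left 1)); apply beta_primitive_at_1, hq.
    - exact (Ccontinuous01_kernel _ q).
    - apply hf.
    - rewrite (is_CInt01_unique _ _ _ (is_CInt01_kernel _ q (pk k) hq) hv
        : kernel_moment p q k = v).
      intros a b ha hb'; eapply Rle_trans; [apply hb; assumption|]. unfold tail.
      replace (2 * H0 a - (2 * l0 + 0 * l0)) with (2 * (H0 a - l0)) by ring.
      replace (2 * H0 b - (2 * l1 + 0 * l1)) with (2 * (H0 b - l1)) by ring.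
      rewrite !Rabs_mult, (Rabs_pos_eq 2) by lra. lra. }
  (* On the degenerate interval at 1/2 the truncated integral is zero, so the truncation error there
     is the moment itself. This bounds all moments at once. *)
  set (M := tail (1 / 2) (1 / 2)).
  assert (hM : forall k, Cnorm (kernel_moment p q k) <= M).
  { intros k; rewrite <- Cnorm_opp.
    replace (- kernel_moment p q k)%cx
      with (CInt (f k) (1 / 2) (1 / 2) - kernel_moment p q k)%cx; [apply htail; lra|].
    unfold CInt; rewrite !RInt_point. unfold zero; simpl. fold Czero.
    apply Cplx_eq; simpl; ring. }
  set (X := fun k => (bsterm w k * kernel_moment p q k)%cx).
  destruct (Cseries_dominated X (fun k => M * bsbound * (/ INR (fact k) * Cnorm w ^ k))
    (M * bsbound * exp (Cnorm w))) as [hT _].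
  { intros k; unfold X; rewrite Cnorm_mul.
    rewrite Rmult_assoc, Rmult_comm.
    apply Rmult_le_compat; try apply Cnorm_pos; [apply hM|apply bsterm_norm_le, Rle_refl]. }
  { apply exp_series_cv. }
  exists (Cseries_sum X); split; [exact hT|].
  intros a b ha hb. fold (tail a b).
  set (G := fun u => (kernel p q u * bs (w * RtoC u))%cx).
  set (Y := fun k => (bsterm w k * CInt (f k) a b)%cx).
  (* The remainder of the exponential majorant; it bounds the remainder of [bs (w * RtoC u)] for all
     [u] in (0,1) simultaneously. *)
  set (tl := fun n => bsbound * exp (Cnorm w)
     - sum_f_R0 (fun k => bsbound * (/ INR (fact k) * Cnorm w ^ k)) n).
  assert (tl0 : Un_cv tl 0).
  { intros eps he; destruct (exp_series_cv bsbound (Cnorm w) eps he) as [N hN].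
    exists N; intros n hn; specialize (hN n hn); unfold Rdist, tl in *.
    rewrite Rabs_minus_sym in hN; rewrite Rminus_0_r; exact hN. }
  assert (hGY : Cseq_cv (Csum_nat Y) (CInt G a b)).
  { apply Cseq_cv_squeeze with (v := fun n => 2 * Rabs (2 * H0 b - 2 * H0 a) * tl n) (N := O).
    2: { replace 0 with (2 * Rabs (2 * H0 b - 2 * H0 a) * 0) by ring.
         apply CV_mult; [|exact tl0]. intros eps he; exists O; intros.
         unfold Rdist; rewrite Rminus_diag, Rabs_R0; exact he. }
    intros n _.
    set (g := fun u => Csum_nat (fun k => bsterm w k * f k u)%cx n).
    assert (cg : Ccontinuous01 g).
    { intros u hu; apply (Ccontinuous_Csum_nat (fun k u => bsterm w k * f k u)%cx).
      intros k; apply Ccontinuous_mul; [apply Ccontinuous_const|exact (Ccontinuous01_kernel _ q u hu)]. }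
    assert (eY : Csum_nat Y n = CInt g a b).
    { unfold g; rewrite CInt_Csum_nat; try assumption.
      - apply Csum_nat_ext; intros k; unfold Y; symmetry; apply CInt_scal; try assumption.
        exact (Ccontinuous01_kernel _ q).
      - intros k u hu; apply Ccontinuous_mul;
          [apply Ccontinuous_const|exact (Ccontinuous01_kernel _ q u hu)]. }
    rewrite eY.
    assert (cG : Ccontinuous01 G) by exact (Ccontinuous01_kernel_bs p q w).
    replace (CInt g a b - CInt G a b)%cx with (CInt (fun u => g u + (- Cone) * G u)%cx a b).
    2: { rewrite CInt_add, CInt_scal; try assumption; [ring|].
         intros u hu; apply Ccontinuous_mul; [apply Ccontinuous_const|apply cG, hu]. }
    eapply Rle_trans.
    - apply (CInt_norm_le (fun u => 2 * tl n * H0 u) (fun u => 2 * tl n * h0 u));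
        try assumption; [apply dH|apply ch| |].
      + intros u hu; apply Ccontinuous_add; [apply cg, hu|].
        apply Ccontinuous_mul; [apply Ccontinuous_const|apply cG, hu].
      + intros u hu.
        replace (g u + - Cone * G u)%cx
          with (kernel p q u * (Csum_nat (bsterm (w * RtoC u)%cx) n - bs (w * RtoC u)))%cx.
        * rewrite Cnorm_mul, Cnorm_sub_sym.
          replace (2 * tl n * h0 u) with (2 * h0 u * tl n) by ring.
          apply Rmult_le_compat; try apply Cnorm_pos; [apply Cnorm_kernel_le; assumption|].
          apply bs_spec, Cnorm_mul_RtoC_le. rewrite Rabs_pos_eq; lra.
        * unfold g, G.
          replace (Csum_nat (fun k => bsterm w k * f k u)%cx n)
            with (kernel p q u * Csum_nat (bsterm (w * RtoC u)%cx) n)%cx; [ring|].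
          rewrite <- Csum_nat_mul_l. apply Csum_nat_ext; intros k.
          unfold f, bsterm; rewrite kernel_add_nat, Cpow_RtoC_mul by lra. ring.
    - right. replace (2 * tl n * H0 b - 2 * tl n * H0 a) with (tl n * (2 * H0 b - 2 * H0 a)) by ring.
      rewrite Rabs_mult, (Rabs_pos_eq (tl n)); [ring|].
      unfold tl. destruct (bs_spec w (Cnorm w) (Rle_refl _)) as [_ hbs].
      eapply Rle_trans; [apply Cnorm_pos|apply (hbs n)]. }
  (* The estimate is proved for the difference of partial sums, term by term, and passes to the
     limit. *)
  apply Cseq_cv_norm_le with (u := fun n => (Csum_nat Y n - Csum_nat X n)%cx) (N := O).
  - intros n _. rewrite <- Csum_nat_sub.
    apply Rle_trans with (sum_f_R0 (fun k => tail a b * bsbound * (/ INR (fact k) * Cnorm w ^ k)) n).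
    + apply Csum_nat_norm_le. intros k; unfold X, Y.
      replace (bsterm w k * CInt (f k) a b - bsterm w k * kernel_moment p q k)%cx
        with ((CInt (f k) a b - kernel_moment p q k) * bsterm w k)%cx by ring.
      rewrite Cnorm_mul, Rmult_assoc.
      apply Rmult_le_compat; try apply Cnorm_pos;
        [apply htail; assumption|apply bsterm_norm_le, Rle_refl].
    + replace (bsbound * exp (Cnorm w) * tail a b)
        with (tail a b * bsbound * exp (Cnorm w)) by ring.
      apply (growing_ineq (sum_f_R0 (fun k => tail a b * bsbound * (/ INR (fact k) * Cnorm w ^ k))));
        [|apply exp_series_cv].
      assert (0 <= tail a b).
      { eapply Rle_trans; [apply Cnorm_pos|apply (htail O); assumption]. }
      intros k; simpl sum_f_R0. rewrite <- (Rplus_0_r (sum_f_R0 _ k)) at 1.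
      apply Rplus_le_compat_l. pose proof bsbound_pos.
      apply Rmult_le_pos; [nra|]. apply Rmult_le_pos; [|apply (pow_le (Cnorm w) (S k)), Cnorm_pos].
      left; apply Rinv_0_lt_compat, (INR_fact_lt_0 (S k)).
  - assert (e : (CInt G a b - Cseries_sum X)%cx = (CInt G a b + (- Cone) * Cseries_sum X)%cx) by ring.
    rewrite e.
    eapply Cseq_cv_ext;
      [|apply Cseq_cv_add; [exact hGY|apply (Cseq_cv_mul (fun _ => (- Cone)%cx));
        [apply Cseq_cv_const|exact hT]]].
    intros n; simpl; ring.
Qed.

(** * Change of variables *)

Lemma sqrt_quad_pos (a x : R) : 0 < a -> 0 < x -> 0 < sqrt (x * x + 2 * a * x).
Proof. intros ha hx; apply sqrt_lt_R0; nra. Qed.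

Lemma Dfun_gt (a x : R) : 0 < a -> 0 < x -> x + a < Dfun a x.
Proof. intros ha hx; unfold Dfun; pose proof (sqrt_quad_pos a x ha hx); lra. Qed.

Definition usub (a x : R) : R := a / Dfun a x.

Lemma usub_bounds (a x : R) : 0 < a -> 0 < x -> 0 < usub a x < 1.
Proof.
  intros ha hx; pose proof (Dfun_gt a x ha hx); unfold usub; split.
  - apply Rdiv_lt_0_compat; lra.
  - apply Rmult_lt_reg_r with (Dfun a x); [lra|].
    unfold Rdiv; rewrite Rmult_assoc, Rinv_l by lra. lra.
Qed.

Lemma Dfun_usub (a x : R) : 0 < a -> 0 < x -> Dfun a x = a / usub a x.
Proof. intros ha hx; pose proof (Dfun_gt a x ha hx); unfold usub; field; lra. Qed.

(** Squaring [D - (x + a) = sqrt (x^2 + 2 a x)] gives [(D - a)^2 = 2 x D]; dividing by [2 D] and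
    putting [u = a / D] yields the formula. *)
Lemma x_usub (a x : R) : 0 < a -> 0 < x ->
  x = a / 2 * ((1 - usub a x) * (1 - usub a x)) / usub a x.
Proof.
  intros ha hx; pose proof (Dfun_gt a x ha hx) as hD; unfold usub.
  assert (e : (Dfun a x - (x + a)) * (Dfun a x - (x + a)) = x * x + 2 * a * x).
  { unfold Dfun. replace (x + a + sqrt (x * x + 2 * a * x) - (x + a))
      with (sqrt (x * x + 2 * a * x)) by ring. apply sqrt_sqrt; nra. }
  set (D := Dfun a x) in *.
  replace (a / 2 * ((1 - a / D) * (1 - a / D)) / (a / D)) with ((D * D - 2 * a * D + a * a) / (2 * D))
    by (field; lra).
  replace (D * D - 2 * a * D + a * a) with (x * (2 * D)) by lra. field; lra.
Qed.

Lemma sqrt_usub (a x : R) : 0 < a -> 0 < x ->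
  sqrt (x * x + 2 * a * x) = a / 2 * ((1 - usub a x) * (1 + usub a x)) / usub a x.
Proof.
  intros ha hx. replace (sqrt (x * x + 2 * a * x)) with (Dfun a x - a - x) by (unfold Dfun; ring).
  pose proof (usub_bounds a x ha hx) as hu.
  pose proof (Dfun_usub a x ha hx) as e1. pose proof (x_usub a x ha hx) as e2.
  set (u := usub a x) in *; clearbody u. rewrite e1, e2. field; lra.
Qed.

(** The derivative of [usub], from [D' = D / sqrt (x^2 + 2 a x)]. *)
Definition dusub (a x : R) : R := - (usub a x / sqrt (x * x + 2 * a * x)).

Lemma is_derive_usub (a x : R) : 0 < a -> 0 < x -> is_derive (usub a) x (dusub a x).
Proof.
  intros ha hx; pose proof (Dfun_gt a x ha hx) as hD; pose proof (sqrt_quad_pos a x ha hx) as hs.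
  unfold dusub, usub, Dfun in *. auto_derive; [repeat split; nra|].
  set (s := sqrt _) in *. field. lra.
Qed.

Lemma continuous_dusub (a x : R) : 0 < a -> 0 < x -> continuous (dusub a) x.
Proof.
  intros ha hx; pose proof (Dfun_gt a x ha hx) as hD; pose proof (sqrt_quad_pos a x ha hx) as hs.
  eapply is_derive_continuous. unfold dusub, usub, Dfun in *. auto_derive; [|reflexivity].
  repeat split; nra.
Qed.

(** Since [usub] decreases, the image interval is traversed backwards; exchanging its ends absorbs
    the sign of [dusub]. *)
Lemma is_RInt_usub (a e b : R) (K : Cplx) (G F : R -> Cplx) :
  0 < a -> 0 < e -> 0 < b -> Ccontinuous01 G ->
  (forall x, 0 < x -> F x = (K * (RtoC (- dusub a x) * G (usub a x)))%cx) ->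
  is_RInt (fun x => Re (F x)) e b (Re (K * CInt G (usub a b) (usub a e))%cx) /\
  is_RInt (fun x => Im (F x)) e b (Im (K * CInt G (usub a b) (usub a e))%cx).
Proof.
  intros ha he hb hG hF.
  assert (pos : forall x, Rmin e b <= x -> 0 < x)
    by (intros x hx; pose proof (Rmin_glb_lt e b 0 he hb); lra).
  assert (key : forall g : R -> R, (forall u, 0 < u < 1 -> continuous g u) ->
    is_RInt (fun x => - dusub a x * g (usub a x)) e b (RInt g (usub a b) (usub a e))).
  { intros g hg.
    rewrite <- (opp_RInt_swap g) by
      (apply continuous01_ex_RInt; [exact hg|apply usub_bounds; assumption|apply usub_bounds; assumption]).
    apply is_RInt_ext with (fun x => opp (scal (dusub a x) (g (usub a x)))).
    - intros x _; unfold opp, scal; simpl; unfold mult; simpl; ring.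
    - apply (is_RInt_opp (V := R_NormedModule)).
      apply (is_RInt_comp (V := R_CompleteNormedModule) g (usub a) (dusub a)).
      + intros x [hx _]; apply hg, usub_bounds; [exact ha|apply pos, hx].
      + intros x [hx _]; split; [apply is_derive_usub|apply continuous_dusub];
          try exact ha; apply pos, hx. }
  pose proof (key (fun u => Re (G u)) (fun u hu => proj1 (hG u hu))) as k1.
  pose proof (key (fun u => Im (G u)) (fun u hu => proj2 (hG u hu))) as k2.
  assert (sc : forall c f l, is_RInt f e b l -> is_RInt (fun x => c * f x) e b (c * l))
    by (intros c f l h; exact (is_RInt_scal f e b c l h)).
  split; simpl.
  - eapply is_RInt_ext; [|apply (is_RInt_minus _ _ e b _ _ (sc (Re K) _ _ k1) (sc (Im K) _ _ k2))].
    intros x [hx _]; rewrite hF by (apply pos; lra). unfold minus, plus, opp; simpl; ring.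
  - eapply is_RInt_ext; [|apply (is_RInt_plus _ _ e b _ _ (sc (Re K) _ _ k2) (sc (Im K) _ _ k1))].
    intros x [hx _]; rewrite hF by (apply pos; lra). unfold plus; simpl; ring.
Qed.

Lemma integrand_usub (a x : R) (lam mu y : Cplx) : 0 < a -> 0 < x ->
  (Rcpow x (mu - Cone) * Rcpow (Dfun a x) (- lam) *
    (besselI0 (y / RtoC (Dfun a x)) + struveL0 (y / RtoC (Dfun a x))))%cx =
  (Rcpow (a / 2) mu * Rcpow a (- lam) *
    (RtoC (- dusub a x) *
      (kernel (lam - mu) (RtoC 2 * mu) (usub a x) * bs (y / RtoC a * RtoC (usub a x))%cx)))%cx.
Proof.
  intros ha hx; rewrite bessel_add_struve.
  pose proof (usub_bounds a x ha hx) as hu.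
  assert (en : - dusub a x = usub a x * usub a x / (a / 2 * ((1 - usub a x) * (1 + usub a x)))).
  { unfold dusub; rewrite sqrt_usub by assumption. field; lra. }
  rewrite en, (Dfun_usub a x ha hx).
  replace (Rcpow x (mu - Cone)%cx) with
    (Rcpow (a / 2 * ((1 - usub a x) * (1 - usub a x)) * / usub a x) (mu - Cone)%cx)
    by (f_equal; symmetry; apply (x_usub a x ha hx)).
  set (u := usub a x) in *.
  assert (ui : 0 < / u) by (apply Rinv_0_lt_compat; lra).
  assert (e1 : 0 < 1 - u) by lra.
  unfold kernel, beta_fun, Rdiv at 3.
  assert (e2 : 0 < (1 - u) * (1 - u)) by nra.
  assert (e3 : 0 < a / 2) by lra.
  assert (e4 : 0 < a / 2 * ((1 - u) * (1 - u))) by nra.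
  replace (a / u) with (a * / u) by reflexivity.
  rewrite !Rcpow_mult by assumption.
  rewrite !Rcpow_inv by lra.
  (* Exponents are split so that only the powers [mu] and [lam] of positive reals remain; what is
     left is an identity of rational functions in these powers, [a] and [u]. *)
  replace (RtoC 2 * mu - Cone)%cx with (mu + (mu - Cone))%cx by (unfold Csub;
    replace (RtoC 2) with (Cone + Cone)%cx by (apply Cplx_eq; simpl; ring); ring).
  replace (lam - mu - Cone)%cx with (lam + (- mu) + - Cone)%cx by ring.
  unfold Csub. rewrite !Rcpow_add, !Rcpow_opp, !Rcpow_1 by lra.
  replace (y / RtoC (a * / u))%cx with (y / RtoC a * RtoC u)%cx.
  2: { rewrite RtoC_mul. change (/ u) with (Rinv u). replace (/ u) with (1 / u) by (field; lra).
       rewrite RtoC_div by lra. fold Cone. field; split; apply RtoC_neq0; lra. }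
  set (B := bs _).
  rewrite !RtoC_div, !RtoC_mul, !RtoC_div, !RtoC_add, !RtoC_sub by nra. fold Cone.
  pose proof (Rcpow_neq0 u mu). pose proof (Rcpow_neq0 u lam). pose proof (Rcpow_neq0 a lam).
  assert (RtoC u <> Czero) by (apply RtoC_neq0; lra).
  assert (RtoC a <> Czero) by (apply RtoC_neq0; lra).
  assert (RtoC 2 <> Czero) by (apply RtoC_neq0; lra).
  field; repeat split; try assumption;
    intros h; apply (f_equal Re) in h; simpl in h; lra.
Qed.

Lemma usub_cv_0 (a d : R) : 0 < a -> 0 < d ->
  exists M, 0 < M /\ forall b, M < b -> usub a b < d.
Proof.
  (* [D(b) > b] gives [usub a b < a / b]. *)
  intros ha hd; exists (a / d). assert (0 < a / d) by (apply Rdiv_lt_0_compat; lra).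
  split; [assumption|]. intros b hb.
  pose proof (Dfun_gt a b ha ltac:(lra)). unfold usub.
  apply Rmult_lt_reg_r with (Dfun a b); [lra|].
  unfold Rdiv; rewrite Rmult_assoc, Rinv_l, Rmult_1_r by lra.
  apply (Rmult_lt_compat_l d) in hb; [|exact hd].
  replace (d * (a / d)) with a in hb by (field; lra). nra.
Qed.

Lemma usub_cv_1 (a d : R) : 0 < a -> 0 < d ->
  exists e0, 0 < e0 /\ forall e, 0 < e < e0 -> 1 - usub a e < d.
Proof.
  (* From [e u = (a/2) (1 - u)^2] and [u < 1] one gets [(a/2) (1 - u)^2 <= e], which excludes
     [1 - u >= d]. *)
  intros ha hd; exists (a / 2 * (d * d)).
  split; [apply Rmult_lt_0_compat; nra|]. intros e he.
  pose proof (usub_bounds a e ha ltac:(lra)) as hu.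
  pose proof (x_usub a e ha ltac:(lra)) as ex.
  set (u := usub a e) in *; clearbody u.
  apply Rnot_le_lt; intros hle.
  assert (h1 : d * d <= (1 - u) * (1 - u)) by nra.
  assert (h2 : a / 2 * ((1 - u) * (1 - u)) <= e).
  { assert (e * u = a / 2 * ((1 - u) * (1 - u))) by (rewrite ex; field; lra). nra. }
  nra.
Qed.

(** * Identification with the Wright series and conclusion *)

(** With [p = lam - mu + k] and [q = 2 mu] the moment is [(1 + p / (p + q)) B(p, q)], and
    [2 p + q = 2 (lam + k)]. The factor [lam + k] is the origin of the pair [(lam + 1, 1)] over
    [(lam, 1)], and the denominator [lam + mu + k] turns [lam + mu] into [1 + lam + mu]. *)
Lemma kernel_moment_eq (lam mu : Cplx) (k : nat) : 0 < Re mu -> Re mu < Re lam ->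
  kernel_moment (lam - mu)%cx (RtoC 2 * mu)%cx k =
  (RtoC 2 * (lam + RtoC (INR k)) / (lam + mu + RtoC (INR k)) *
    (CGamma (lam - mu + RtoC (INR k)) * CGamma (RtoC 2 * mu) / CGamma (lam + mu + RtoC (INR k))))%cx.
Proof.
  intros hmu hml; pose proof (pos_INR k) as hk. unfold kernel_moment.
  set (p := (lam - mu + RtoC (INR k))%cx).
  assert (hp : 0 < Re p) by (unfold p; simpl; lra).
  assert (hq : 0 < Re (RtoC 2 * mu)%cx) by (simpl; lra).
  assert (hs : 0 < Re (lam + mu + RtoC (INR k))%cx) by (simpl; lra).
  rewrite Beta_succ_l by assumption.
  pose proof (Beta_CGamma p _ hp hq) as e.
  assert (e1 : (p + RtoC 2 * mu)%cx = (lam + mu + RtoC (INR k))%cx)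
    by (unfold p; apply Cplx_eq; simpl; ring).
  rewrite e1 in *. rewrite e.
  replace p with (lam + mu + RtoC (INR k) - RtoC 2 * mu)%cx at 2 by (rewrite <- e1; ring).
  replace (RtoC 2) with (Cone + Cone)%cx by (apply Cplx_eq; simpl; ring).
  field; split; [apply CGamma_neq0, hs|apply Cpos_neq0, hs].
Qed.

(** Duplication rewrites [(1/2)^k / Gamma(k/2 + 1)^2] as [Gamma(1/2 + k/2) / (sqrt PI * k! * Gamma(1
    + k/2))], which supplies the parameters of step 1/2, the factorial and [sqrt PI]. The 2 of the
    moment joins [(a/2)^mu a^(-lam)] to form [2^(1-mu) a^(mu-lam)]. *)
Lemma wright_term_eq (a : R) (lam mu w : Cplx) (k : nat) :
  0 < a -> 0 < Re mu -> Re mu < Re lam ->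
  (Rcpow (a / 2) mu * Rcpow a (- lam) *
    (bsterm w k * kernel_moment (lam - mu) (RtoC 2 * mu) k))%cx =
  (Rcpow 2 (Cone - mu) * Rcpow a (mu - lam) * CGamma (RtoC 2 * mu) / RtoC (sqrt PI) *
    wright_term
      ((RtoC (1 / 2), (1 / 2)%R) :: (lam + Cone, 1%R) :: (lam - mu, 1%R) :: nil)
      ((Cone, (1 / 2)%R) :: (lam, 1%R) :: (Cone + lam + mu, 1%R) :: nil) w k)%cx.
Proof.
  intros ha hmu hml; pose proof (pos_INR k) as hk.
  unfold wright_term, bsterm; cbn [map fst snd Cprod_list fold_right].
  rewrite kernel_moment_eq, RtoC_bscoef, !Rmult_1_l by assumption.
  replace (lam + Cone + RtoC (INR k))%cx with (lam + RtoC (INR k) + Cone)%cx by ring.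
  replace (Cone + lam + mu + RtoC (INR k))%cx with (lam + mu + RtoC (INR k) + Cone)%cx by ring.
  rewrite !CGamma_succ by (simpl; lra).
  pose proof (CGamma_duplication_nat k) as dup.
  assert (g0 : CGamma (Cone + RtoC (1 / 2 * INR k))%cx <> Czero)
    by (apply CGamma_neq0; simpl; lra).
  assert (hs : 0 < Re (lam + mu + RtoC (INR k))%cx) by (simpl; lra).
  assert (hl : 0 < Re (lam + RtoC (INR k))%cx) by (simpl; lra).
  assert (spi : RtoC (sqrt PI) <> Czero).
  { apply RtoC_neq0, Rgt_not_eq, sqrt_lt_R0, PI_RGT_0. }
  set (h := CGamma (RtoC (1 / 2) + RtoC (1 / 2 * INR k))%cx) in *.
  set (g := CGamma (Cone + RtoC (1 / 2 * INR k))%cx) in *.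
  replace h with (h * g / g)%cx by (field; exact g0).
  rewrite dup.
  unfold Rdiv at 1; rewrite Rcpow_mult, Rcpow_inv by lra.
  rewrite !Rcpow_sub, Rcpow_opp, Rcpow_1 by lra.
  pose proof (Rcpow_neq0 2 mu). pose proof (Rcpow_neq0 a lam).
  pose proof (CGamma_neq0 _ hs). pose proof (CGamma_neq0 _ hl).
  pose proof (RtoC_fact_neq0 k). pose proof (Cpos_neq0 _ hs).
  generalize (RtoC 2). intros two.
  field. repeat split; assumption.
Qed.

Theorem theorem3 (a : R) (lam mu y : Cplx)
  (ha : 0 < a) (hmu : 0 < Re mu) (hml : Re mu < Re lam) :
  improper_int_0_inf
    (fun x => Cmul (Cmul (Rcpow x (Csub mu Cone)) (Rcpow (Dfun a x) (Copp lam)))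
                   (Cadd (besselI0 (Cdiv y (RtoC (Dfun a x))))
                         (struveL0 (Cdiv y (RtoC (Dfun a x))))))
    (Cmul (Cdiv (Cmul (Cmul (Rcpow 2 (Csub Cone mu)) (Rcpow a (Csub mu lam)))
                      (CGamma (Cmul (RtoC 2) mu)))
                (RtoC (sqrt PI)))
          (wrightPsi
             ((RtoC (1/2), 1/2) :: (Cadd lam Cone, 1) :: (Csub lam mu, 1) :: nil)
             ((Cone, 1/2) :: (lam, 1) :: (Cadd (Cadd Cone lam) mu, 1) :: nil)
             (Cdiv y (RtoC a)))).
Proof.
  assert (hp : 0 < Re (lam - mu)%cx) by (simpl; lra).
  assert (hq : 0 < Re (RtoC 2 * mu)%cx) by (simpl; lra).
  set (p := (lam - mu)%cx) in *. set (q := (RtoC 2 * mu)%cx) in *. set (w := (y / RtoC a)%cx).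
  set (K := (Rcpow (a / 2) mu * Rcpow a (- lam))%cx).
  destruct (CInt_kernel_bs p q w hp hq) as [T [hT hI]].
  match goal with |- improper_int_0_inf _ (?c * wrightPsi ?A ?B w)%cx =>
    set (C0 := c); set (LA := A); set (LB := B) end.
  (* [wrightPsi] is accessible only through the limit of its own series, so the termwise identity
     has to be divided by [C0]. *)
  assert (C0_neq0 : C0 <> Czero).
  { assert (spi : RtoC (sqrt PI) <> Czero)
      by (apply RtoC_neq0, Rgt_not_eq, sqrt_lt_R0, PI_RGT_0).
    intros h. apply (Cmul_neq0 (Rcpow 2 (Cone - mu) * Rcpow a (mu - lam))%cx (CGamma q)).
    - apply Cmul_neq0; apply Rcpow_neq0.
    - apply CGamma_neq0, hq.
    - replace (Rcpow 2 (Cone - mu) * Rcpow a (mu - lam) * CGamma q)%cx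
        with (C0 * RtoC (sqrt PI))%cx by (unfold C0; field; exact spi).
      rewrite h; ring. }
  assert (hPsi : (C0 * wrightPsi LA LB w)%cx = (K * T)%cx).
  { unfold wrightPsi. rewrite (Cseries_sum_eq _ (K / C0 * T)%cx); [field; exact C0_neq0|].
    eapply Cseq_cv_ext; [|apply (Cseq_cv_mul (fun _ => (K / C0)%cx)); [apply Cseq_cv_const|exact hT]].
    intros n; simpl; rewrite <- Csum_nat_mul_l; apply Csum_nat_ext; intros k.
    replace (K / C0 * (bsterm w k * kernel_moment p q k))%cx
      with ((K * (bsterm w k * kernel_moment p q k)) / C0)%cx by (field; exact C0_neq0).
    assert (e : (K * (bsterm w k * kernel_moment p q k) = C0 * wright_term LA LB w k)%cx)
      by exact (wright_term_eq a lam mu w k ha hmu hml).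
    rewrite e.
    field; exact C0_neq0. }
  rewrite hPsi. intros eps heps.
  set (S := Cnorm K * (bsbound * exp (Cnorm w))) in *.
  assert (hS : 0 <= S).
  { pose proof bsbound_pos. pose proof (exp_pos (Cnorm w)).
    apply Rmult_le_pos; [apply Cnorm_pos|nra]. }
  (* Both ends contribute [eta] to the factor 4 of [hI], which makes [8 * eta]; the [+ 1] gives the
     strict inequality [S / (S + 1) < 1]. *)
  set (eta := eps / (8 * (S + 1))).
  assert (heta : 0 < eta) by (apply Rdiv_lt_0_compat; lra).
  destruct (beta_primitive_at_0 (Re p) (Re q) hp
    (fun z => Rabs (z - - (2 / Re q)) < eta)) as [d0 hd0];
    [exists (mkposreal eta heta); intros z hz; exact hz|].
  destruct (beta_primitive_at_1 (Re p) (Re q) hq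
    (fun z => Rabs (z - 2 / Re p) < eta)) as [d1 hd1];
    [exists (mkposreal eta heta); intros z hz; exact hz|].
  destruct (usub_cv_1 a d1 ha (cond_pos d1)) as [e0 [he0 hu1]].
  destruct (usub_cv_0 a d0 ha (cond_pos d0)) as [M [hM hu0]].
  exists e0, M; split; [exact he0|]. intros e b he hb.
  assert (hb0 : 0 < b) by lra.
  pose proof (usub_bounds a e ha ltac:(lra)) as be.
  pose proof (usub_bounds a b ha hb0) as bb.
  destruct (is_RInt_usub a e b K _ _ ha (proj1 he) hb0 (Ccontinuous01_kernel_bs p q w)
    (fun x hx => integrand_usub a x lam mu y ha hx)) as [i1 i2].
  exists (ex_RInt_Reals_0 _ _ _ (ex_intro _ _ i1)), (ex_RInt_Reals_0 _ _ _ (ex_intro _ _ i2)).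
  rewrite <- !RInt_Reals. rewrite (is_RInt_unique _ _ _ _ i1), (is_RInt_unique _ _ _ _ i2).
  set (V := CInt _ _ _) in *.
  replace (mkC (Re (K * V)%cx) (Im (K * V)%cx) - K * T)%cx with (K * (V - T))%cx
    by (apply Cplx_eq; simpl; ring).
  rewrite Cnorm_mul.
  (* The upper limit [b] corresponds to the end of (0,1) at 0, and the lower limit [e] to the end at
     1. *)
  pose proof (hI _ _ bb be) as hV; fold V in hV.
  assert (h0 : Rabs (beta_primitive (Re p) (Re q) (usub a b) - - (2 / Re q)) < eta).
  { apply (hd0 (usub a b)); [|lra]. change (Rabs (usub a b - 0) < d0).
    rewrite Rminus_0_r, Rabs_pos_eq by lra. apply hu0, hb. }
  assert (h1 : Rabs (beta_primitive (Re p) (Re q) (usub a e) - 2 / Re p) < eta).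
  { apply (hd1 (usub a e)); [|lra]. change (Rabs (usub a e - 1) < d1).
    rewrite Rabs_minus_sym, Rabs_pos_eq by lra. apply hu1, he. }
  apply Rle_lt_trans with (S * (8 * eta)).
  - unfold S. rewrite Rmult_assoc. apply Rmult_le_compat_l; [apply Cnorm_pos|].
    eapply Rle_trans; [exact hV|]. apply Rmult_le_compat_l; [|lra].
    pose proof bsbound_pos; pose proof (exp_pos (Cnorm w)); nra.
  - replace (S * (8 * eta)) with (eps * (S / (S + 1))) by (unfold eta; field; lra).
    rewrite <- (Rmult_1_r eps) at 2. apply Rmult_lt_compat_l; [exact heps|].
    apply Rmult_lt_reg_r with (S + 1); [lra|].
    unfold Rdiv; rewrite Rmult_assoc, Rinv_l by lra. lra.
Qed.
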